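(* Let $M,N$ be submodules of a finitely generated $R$-module $L$. For almost all $\alpha$ there are canonical isomorphisms: (i) $(L/M)_\alpha\cong L_\alpha/M_\alpha$; (ii) $(M\cap N)_\alpha\cong M_\alpha\cap N_\alpha$; (iii) $(M+N)_\alpha\cong M_\alpha+N_\alpha$.
   Context: Let $k$ be an arbitrary infinite field, $u=(u_1,\ldots,u_m)$ and $x=(x_1,\ldots,x_n)$ indeterminates, and $R=k(u)[x]$. Let $K$ be an extension field of $k$; for $\alpha\in K^m$ put $R_\alpha=k(\alpha)[x]$. A property holds for almost all $\alpha$ if it holds for all $\alpha\in K^m$ except perhaps those lying on a proper algebraic subvariety of $K^m$ (which may depend on the given data). Every $a\in R$ can be written $a(u,x)=p(u,x)/q(u)$ with $p\in k[u,x]$, $q\in k[u]\setminus\{0\}$; for $\alpha$ with $q(\alpha)\neq 0$ put $a(\alpha,x)=p(\alpha,x)/q(\alpha)\in R_\alpha$. For a matrix $A=(a_{ij}(u,x))$ over $R$ put $A_\alpha=(a_{ij}(\alpha,x))$; this is defined for almost all $\alpha$. The specialization $F_\alpha$ of a free $R$-module $F$ of finite rank is a free $R_\alpha$-module of the same rank. With bases fixed, the specialization $\phi_\alpha:F_\alpha\to G_\alpha$ of a homomorphism $\phi:F\to G$ of free $R$-modules of finite ranks with matrix $A$ is the homomorphism with matrix $A_\alpha$. Each finitely generated $R$-module $L$ is considered together with a fixed (arbitrary) finite free presentation $F_1\xrightarrow{\phi}F_0\to L\to 0$ (free modules of finite ranks), and its specialization is $L_\alpha:=\operatorname{Coker}\phi_\alpha$.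 For a homomorphism $v:L\to M$, with presentations $F_1\xrightarrow{\phi}F_0\to L\to0$ and $G_1\xrightarrow{\psi}G_0\to M\to0$, choose lifts $v_0:F_0\to G_0$, $v_1:F_1\to G_1$ making the diagram of presentations commute; for almost all $\alpha$ the specialization $v_\alpha:L_\alpha\to M_\alpha$ is the homomorphism induced by $(v_0)_\alpha$ on cokernels. If $M$ is a submodule of $L$, the specialization $M_\alpha\to L_\alpha$ of the inclusion is injective for almost all $\alpha$, and $M_\alpha$ is identified with its image in $L_\alpha$; sums, intersections and quotients of specialized submodules are taken inside $L_\alpha$. ''Canonical'' means: in (i) induced by the specialization $L_\alpha\to(L/M)_\alpha$ of the projection; in (ii), (iii) given by the specialization of the inclusion of $M\cap N$, respectively $M+N$, into $L$. *)

(* Defs.v *)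
From HB Require Import structures.
From mathcomp Require Import all_boot all_order all_algebra.
From mathcomp Require Import generic_quotient ring_quotient.
From mathcomp Require Import mpoly.
From mathcomp Require Import boolp.
From mathcomp Require classical_sets cardinality.

Set Implicit Arguments.
Unset Strict Implicit.
Unset Printing Implicit Defensive.

Import GRing.Theory.
Local Open Scope ring_scope.
Local Open Scope quotient_scope.

Definition infinite_type (T : Type) : Prop :=
  cardinality.infinite_set (@classical_sets.setT T).

(* Submodules are boolean predicates in [submodClosed]; arbitrary
   propositional ones are obtained through [asbool]. *)
Section Modules.
Variable R : nzRingType.

Definition fin_gen (V : lmodType R) : Prop :=
  exists (r : nat) (g : 'I_r -> V),
    forall x : V, exists c : 'I_r -> R, x = \sum_(i < r) c i *: g i.

Section SubType.
Variables (V : lmodType R) (S : submodClosed V).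

Definition submod : Type := {x : V | x \in S}.

HB.instance Definition _ := SubChoice.on submod.
HB.instance Definition _ := [SubChoice_isSubLmodule of submod by <:].

Definition incl : submod -> V := val.

Fact incl_is_linear : linear incl.
Proof. by move=> a x y; exact: (linearP (val : submod -> V)). Qed.

HB.instance Definition _ :=
  GRing.isLinear.Build R submod V *:%R incl incl_is_linear.
End SubType.

Section Quotient.
Variables (V : lmodType R) (S : submodClosed V).

(* [submodClosed] carries no closure under opposite, which the quotient
   construction for abelian groups requires. *)
Definition zmod_of : {pred V} := fun x => x \in S.

Fact zmod_of_closed : zmod_closed zmod_of.
Proof. exact/GRing.submod_closedB/submodClosedP. Qed.

HB.instance Definition _ := GRing.isZmodClosed.Build V zmod_of zmod_of_closed.

Definition quotmod : Type := Quotient.quot zmod_of.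

HB.instance Definition _ := GRing.Zmodule.on quotmod.

Definition qproj (x : V) : quotmod := \pi_(Quotient.quot zmod_of) x.
Definition qscale (a : R) (x : quotmod) : quotmod :=
  qproj (a *: repr (x : Quotient.quot zmod_of)).

Fact qprojK (x : quotmod) : qproj (repr (x : Quotient.quot zmod_of)) = x.
Proof. exact: reprK. Qed.

Fact qproj_eq x y : (qproj x == qproj y) = (x - y \in S).
Proof. by rewrite /qproj -Quotient.idealrBE. Qed.

Fact qprojB : zmod_morphism qproj.
Proof. by move=> x y; rewrite /qproj raddfB. Qed.

HB.instance Definition _ := GRing.isZmodMorphism.Build V quotmod qproj qprojB.

Fact qprojZ a x : qproj (a *: x) = qscale a (qproj x).
Proof.
apply/eqP; rewrite /qscale qproj_eq -scalerBr rpredZ //.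
by rewrite -qproj_eq qprojK.
Qed.

Fact qscaleA a b x : qscale a (qscale b x) = qscale (a * b) x.
Proof. by rewrite -[x]qprojK -!qprojZ scalerA. Qed.

Fact qscale1 : left_id 1 qscale.
Proof. by move=> x; rewrite -[x]qprojK -!qprojZ scale1r. Qed.

Fact qscaleDr : right_distributive qscale +%R.
Proof.
move=> a x y; rewrite -[x]qprojK -[y]qprojK -raddfD -!qprojZ.
by rewrite scalerDr raddfD.
Qed.

Fact qscaleDl x : {morph qscale^~ x : a b / a + b}.
Proof. by move=> a b; rewrite -[x]qprojK -!qprojZ scalerDl raddfD. Qed.

HB.instance Definition _ := GRing.Zmodule_isLmodule.Build R quotmod
  qscaleA qscale1 qscaleDr qscaleDl.

Fact qproj_scalable : scalable qproj.
Proof. by move=> a x; rewrite qprojZ. Qed.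

HB.instance Definition _ :=
  GRing.isScalable.Build R V quotmod *:%R qproj qproj_scalable.
End Quotient.

Section Image.
Variables (V W : lmodType R) (f : {linear V -> W}).

Definition limage : {pred W} := fun y => `[< exists x, y = f x >].

Fact limage_closed : subsemimod_closed limage.
Proof.
split; [split|].
- by apply/asboolP; exists 0; rewrite raddf0.
- move=> _ _ /asboolP[x ->] /asboolP[y ->].
  by apply/asboolP; exists (x + y); rewrite raddfD.
- by move=> a _ /asboolP[x ->]; apply/asboolP; exists (a *: x); rewrite linearZ.
Qed.

HB.instance Definition _ := GRing.isSubmodClosed.Build R W limage limage_closed.
End Image.

Section Lattice.
Variables (V : lmodType R) (S T : submodClosed V).

Definition submodI : {pred V} := fun x => (x \in S) && (x \in T).

Definition submodD : {pred V} :=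
  fun x => `[< exists y z, [/\ y \in S, z \in T & x = y + z] >].

Fact submodI_closed : subsemimod_closed submodI.
Proof.
split; [split|].
- by apply/andP; rewrite !rpred0.
- by move=> x y /andP[? ?] /andP[? ?]; apply/andP; rewrite !rpredD.
- by move=> a x /andP[? ?]; apply/andP; rewrite !rpredZ.
Qed.

Fact submodD_closed : subsemimod_closed submodD.
Proof.
split; [split|].
- by apply/asboolP; exists 0, 0; rewrite !rpred0 addr0.
- move=> _ _ /asboolP[x [y [Sx Ty ->]]] /asboolP[z [t [Sz Tt ->]]].
  by apply/asboolP; exists (x + z), (y + t); rewrite !rpredD // addrACA.
- move=> a _ /asboolP[x [y [Sx Ty ->]]].
  by apply/asboolP; exists (a *: x), (a *: y); rewrite !rpredZ // scalerDr.
Qed.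

HB.instance Definition _ :=
  GRing.isSubmodClosed.Build R V submodI submodI_closed.
HB.instance Definition _ :=
  GRing.isSubmodClosed.Build R V submodD submodD_closed.
End Lattice.

End Modules.

Arguments incl {R V} S.
Arguments qproj {R V} S.

(* Free modules of finite rank with a fixed basis are the row modules
   'rV[R]_r; a homomorphism with matrix A is x |-> x *m A. *)
Section Presentations.
Variable R : comNzRingType.

Definition coker r s (A : 'M[R]_(r, s)) : lmodType R :=
  quotmod (limage (mulmxr A : {linear 'rV[R]_r -> 'rV[R]_s})).

Definition coker_proj r s (A : 'M[R]_(r, s)) : {linear 'rV[R]_s -> coker A} :=
  qproj (limage (mulmxr A : {linear 'rV[R]_r -> 'rV[R]_s})).

Record presentation (L : lmodType R) := Presentation {
  rank1 : nat;
  rank0 : nat;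
  pres_mx : 'M[R]_(rank1, rank0);
  pres_map : {linear 'rV[R]_rank0 -> L};
  pres_surj : forall y : L, exists x, y = pres_map x;
  pres_exact : forall x : 'rV[R]_rank0,
    pres_map x = 0 <-> exists z : 'rV[R]_rank1, x = z *m pres_mx
}.

Record pres_lift (L M : lmodType R) (F : presentation L) (G : presentation M)
    (v : {linear L -> M}) := Lift {
  lift0 : 'M[R]_(rank0 F, rank0 G);
  lift1 : 'M[R]_(rank1 F, rank1 G);
  lift0P : forall x, pres_map G (x *m lift0) = v (pres_map F x);
  lift1P : pres_mx F *m lift0 = lift1 *m pres_mx G
}.
End Presentations.

Notation ratpoly k m n := {mpoly {fraction {mpoly k[m]}}[n]}.

Section AlmostAll.
Variables (K : fieldType) (m : nat).

Definition zero_locus (I : {mpoly K[m]} -> Prop) (alpha : 'I_m -> K) : Prop :=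
  forall f, I f -> f.@[alpha] = 0.

Definition almost_all (P : ('I_m -> K) -> Prop) : Prop :=
  exists I : {mpoly K[m]} -> Prop,
    (exists alpha, ~ zero_locus I alpha) /\
    (forall alpha, ~ zero_locus I alpha -> P alpha).
End AlmostAll.

Section Specialization.
Variables (k K : fieldType) (iota : {rmorphism k -> K}) (m n : nat).
Variable alpha : 'I_m -> K.

Definition in_adjoin (z : K) : Prop :=
  forall S : divringClosed K,
    (forall c, iota c \in S) -> (forall i, alpha i \in S) -> z \in S.

Definition adjoin_pred : {pred K} := fun z => `[< in_adjoin z >].

Fact adjoin_closed : divring_closed adjoin_pred.
Proof.
split.
- by apply/asboolP => S _ _; exact: rpred1.
- move=> x y /asboolP Hx /asboolP Hy; apply/asboolP => S h1 h2.
  by rewrite rpredB ?Hx ?Hy.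
- move=> x y /asboolP Hx /asboolP Hy; apply/asboolP => S h1 h2.
  by rewrite rpred_div ?Hx ?Hy.
Qed.

HB.instance Definition _ :=
  GRing.isDivringClosed.Build K adjoin_pred adjoin_closed.

(* k(alpha), the intersection of all subfields of K containing iota(k) and
   the coordinates of alpha. *)
Definition adjoin : Type := {z : K | z \in adjoin_pred}.

HB.instance Definition _ := SubChoice.on adjoin.
HB.instance Definition _ := [SubChoice_isSubIntegralDomain of adjoin by <:].
HB.instance Definition _ := [SubIntegralDomain_isSubField of adjoin by <:].

Fact adjoin_iota c : iota c \in adjoin_pred.
Proof. by apply/asboolP => S h _; exact: h. Qed.

Fact adjoin_point i : alpha i \in adjoin_pred.
Proof. by apply/asboolP => S _ h; exact: h. Qed.

Definition to_adjoin (c : k) : adjoin := Sub (iota c) (adjoin_iota c).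

Fact to_adjoin_zmod : zmod_morphism to_adjoin.
Proof. by move=> x y; apply: val_inj; rewrite /= rmorphB. Qed.

Fact to_adjoin_monoid : monoid_morphism to_adjoin.
Proof.
by split=> [|x y]; apply: val_inj; rewrite /= ?rmorph1 ?rmorphM.
Qed.

HB.instance Definition _ :=
  GRing.isZmodMorphism.Build k adjoin to_adjoin to_adjoin_zmod.
HB.instance Definition _ :=
  GRing.isMonoidMorphism.Build k adjoin to_adjoin to_adjoin_monoid.

Definition point (i : 'I_m) : adjoin := Sub (alpha i) (adjoin_point i).

Definition eval_u (q : {mpoly k[m]}) : adjoin := mmap to_adjoin point q.

HB.instance Definition _ := GRing.RMorphism.copy eval_u (mmap to_adjoin point).

(* k[u, x] is encoded as k[u][x]. *)
Definition spec_poly (a : ratpoly k m n) (b : {mpoly adjoin[n]}) : Prop :=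
  exists (p : {mpoly {mpoly k[m]}[n]}) (q : {mpoly k[m]}),
    [/\ q != 0,
        a = (tofrac q)^-1 *: map_mpoly (@tofrac _) p,
        eval_u q != 0 &
        b = (eval_u q)^-1 *: map_mpoly eval_u p].

Definition specializable (a : ratpoly k m n) : Prop := exists b, spec_poly a b.

(* The value 0 outside the domain of definition is a dummy. *)
Definition spec (a : ratpoly k m n) : {mpoly adjoin[n]} :=
  if pselect (specializable a) is left h then sval (cid h) else 0.

Definition mx_specializable r s (A : 'M[ratpoly k m n]_(r, s)) : Prop :=
  forall i j, specializable (A i j).

Definition spec_mx r s (A : 'M[ratpoly k m n]_(r, s)) :
  'M[{mpoly adjoin[n]}]_(r, s) := map_mx spec A.

Definition spec_mod (L : lmodType (ratpoly k m n)) (F : presentation L) :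
  lmodType {mpoly adjoin[n]} := coker (spec_mx (pres_mx F)).

(* [spec_hom l w]: the specialization of v computed from the lift l of v is
   defined, and it is w. *)
Definition spec_hom (L M : lmodType (ratpoly k m n)) (F : presentation L)
    (G : presentation M) (v : {linear L -> M}) (l : pres_lift F G v)
    (w : {linear spec_mod F -> spec_mod G}) : Prop :=
  [/\ mx_specializable (pres_mx F), mx_specializable (pres_mx G),
      mx_specializable (lift0 l), mx_specializable (lift1 l) &
      forall x, w (coker_proj (spec_mx (pres_mx F)) x) =
                coker_proj (spec_mx (pres_mx G)) (x *m spec_mx (lift0 l))].

End Specialization.

(* Main.v *)
(* Everything reduces to one transfer principle: an implication
   "x C = 0 implies x D is a combination of the rows of A" between matrices
   over k(u)[x] remains true for the specialized matrices, for almost all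
   alpha.  It follows once every syzygy of C_alpha is a combination of
   specialized syzygies of C.  Eliminating one column after the other, this has
   to be known for a single column only, that is, for an ideal.  There one takes
   a Groebner basis with leading coefficients 1 together with a standard
   representation of each S-pair.  These are finitely many identities and degree
   bounds, so they specialize, and by Schreyer's theorem the S-pair syzygies
   generate all the syzygies, before as well as after specialization.
   Injectivity, exactness, intersections and sums of homomorphisms of presented
   modules are all implications of this kind between the lifting matrices. *)

Require Import Defs.
From HB Require Import structures.
From mathcomp Require Import all_boot all_order all_algebra.
From mathcomp Require Import generic_quotient.
From mathcomp Require Import mpoly.
From mathcomp Require Import boolp ring.
From mathcomp Require cardinality.

Set Implicit Arguments.
Unset Strict Implicit.
Unset Printing Implicit Defensive.

Import Order.TTheory GRing.Theory.
Local Open Scope ring_scope.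
Local Open Scope quotient_scope.

(** * Values of polynomials over an infinite field *)

(** Some finite set of scalars has at least [size p] elements, which is more than the number of
    roots of a nonzero [p]. *)
Lemma poly_nonroot (k : fieldType) : infinite_type k ->
  forall p : {poly k}, p != 0 -> exists t, ~~ root p t.
Proof.
move=> k_inf p p0.
have [A _ dA] := cardinality.infinite_set_fset (size p) k_inf.
apply: contrapT => nroot.
have := @max_poly_roots _ p (finmap.enum_fset A) p0.
rewrite finmap.fset_uniq leqNgt ltnS dA /= => H.
suff: false by []; apply: H => //.
by apply/allP => t _; apply: contrapT => /negP pt; apply: nroot; exists t.
Qed.

(** Induction on the number of variables: [muni] makes [p] univariate in the last variable, a
    nonzero coefficient gets a nonvanishing point [v], and the polynomial evaluated at [v] has a
    non-root [t], used as last coordinate. *)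
Lemma nonzero_mpoly_value (k : fieldType) : infinite_type k ->
  forall m (p : {mpoly k[m]}), p != 0 -> exists v : 'I_m -> k, p.@[v] != 0.
Proof.
move=> k_inf; elim=> [|m IHm] p p0.
  exists (fun=> 0); apply: contra p0.
  by rewrite [p in p.@[_]]nvar0_mpolyC mevalC [p in _ -> p == 0]nvar0_mpolyC =>
    /eqP->; rewrite mpolyC0.
pose low (a : 'X_{1..m.+1}) := [multinom a (widen_ord (leqnSn m) i) | i < m].
have lowP a b : low a = low b -> a ord_max = b ord_max -> a = b.
  move=> ab ab_max; apply/mnmP => i; case: (unliftP ord_max i) => [j ->|->//].
  have := congr1 (fun c : 'X_{1..m} => c j) ab; rewrite !mnmE.
  by have -> : widen_ord (leqnSn m) j = lift ord_max j by apply/val_inj;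
    rewrite /= /bump leqNgt ltn_ord.
(* No coefficient is lost by [muni]: an exponent is determined by its last entry and the remaining
   ones. So [muni p] has a nonzero coefficient. *)
have coefE a : ((muni p)`_(a ord_max))@_(low a) = p@_a.
  rewrite muniE coef_sum raddf_sum /=.
  rewrite [in RHS](mpolyE p) raddf_sum /=; apply: eq_bigr => b _.
  rewrite coefZ coefXn mulr_natr mcoeffMn !mcoeffZ !mcoeffX -mulrnAr.
  congr (_ * _); rewrite -mulrnA; congr (_ %:R).
  have [->|/eqP ab] := eqVneq b a; first by rewrite !eqxx.
  case: eqVneq => //= lab; case: eqVneq => //= mab.
  by case: ab; exact: lowP.
have [a ap] : exists a, p@_a != 0.
  by exists (mlead p); rewrite mleadc_eq0.
pose c := (muni p)`_(a ord_max).
have /IHm[v cv] : c != 0 by apply: contraNneq ap => c0;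
  rewrite -coefE -/c c0 mcoeff0.
have : map_poly (meval v) (muni p) != 0.
  apply: contraNneq cv => /(congr1 (fun q : {poly k} => q`_(a ord_max))).
  by rewrite coef_map coef0 /= => ->.
case/(poly_nonroot k_inf) => t; rewrite /root => pt.
exists (fun i => if unlift ord_max i is Some j then v j else t).
apply: contraNneq pt => <-.
rewrite muniE rmorph_sum /= horner_sum mevalE; apply/eqP/eq_bigr => b _.
rewrite map_polyZ map_polyXn hornerZ hornerXn /= mevalZ mevalX -mulrA.
congr (_ * _); rewrite big_ord_recr /= unlift_none; congr (_ * _).
apply: eq_bigr => i _; rewrite mnmE.
have -> : widen_ord (leqnSn m) i = lift ord_max i.
  by apply/val_inj; rewrite /= /bump leqNgt ltn_ord.
by rewrite liftK.
Qed.

(** * Groebner bases and Schreyer's theorem *)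

(** Induction on the number [d] of coordinates that are compared. A list settling the first [d]
    coordinates also settles every element whose next exponent is large; the finitely many small
    values of that exponent give slices, each settled by induction. *)
Lemma dickson n (P : 'X_{1..n} -> Prop) :
  exists s : seq 'X_{1..n}, (forall a, a \in s -> P a) /\
    forall a, P a -> exists2 b, b \in s & (b <= a)%MM.
Proof.
suff dominated d : forall Q : 'X_{1..n} -> Prop, exists s : seq 'X_{1..n},
    (forall a, a \in s -> Q a) /\
    forall a, Q a -> exists2 b, b \in s & forall i : 'I_n, (i < d -> b i <= a i)%N.
  have [s [sP Ps]] := dominated n P; exists s; split=> // a /Ps[b bs ba].
  by exists b => //; apply/mnm_lepP => i; exact: ba.
elim: d => [|d IHd] {}P.
  have [[a aP]|nP] := pselect (exists a, P a).
    by exists [:: a]; split=> [b|b _]; [rewrite inE => /eqP->|exists a;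
      rewrite ?inE].
  by exists [::]; split=> // a aP; case: nP; exists a.
have [nd|dn] := leqP n d.
  have [s [sP Ps]] := IHd P; exists s; split=> // a /Ps[b bs ba].
  by exists b => // i _; apply: ba; exact: leq_trans (ltn_ord i) nd.
pose j := Ordinal dn.
have [s [sP Ps]] := IHd P.
(* [B] bounds the [j]-th exponent of every member of [s], so [s] already suffices for the elements
   with exponent at least [B]. *)
pose B := (\sum_(b <- s) b j)%N.
have [t [tP Pt]] : exists t : seq 'X_{1..n}, (forall a, a \in t -> P a) /\
    forall a, P a -> (a j < B)%N ->
    exists2 b, b \in t & forall i : 'I_n, (i < d.+1 -> b i <= a i)%N.
  elim: B => [|B [t [tP Pt]]]; first by exists [::].
  have [u [uP Pu]] := IHd (fun a => P a /\ a j = B).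
  exists (t ++ u); split=> [a|a aP].
    by rewrite mem_cat => /orP[/tP|/uP[]].
  rewrite ltnS leq_eqVlt => /orP[/eqP aB|/(Pt a aP)[b bt ba]]; last first.
    by exists b; rewrite ?mem_cat ?bt.
  have [b bu ba] := Pu a (conj aP aB); exists b; first by rewrite mem_cat bu orbT.
  move=> i; rewrite ltnS leq_eqVlt => /orP[/eqP id|]; last exact: ba.
  have -> : i = j by exact/val_inj.
  by rewrite aB; case: (uP _ bu) => _ ->.
exists (s ++ t); split=> [a|a aP]; first by rewrite mem_cat => /orP[/sP|/tP].
have [aB|Ba] := ltnP (a j) B.
  by have [b bt ba] := Pt a aP aB; exists b; rewrite ?mem_cat ?bt ?orbT.
have [b bs ba] := Ps a aP; exists b; first by rewrite mem_cat bs.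
move=> i; rewrite ltnS leq_eqVlt => /orP[/eqP id|]; last exact: ba.
have -> : i = j by exact/val_inj.
by apply: leq_trans Ba; rewrite /B (big_rem b) //= leq_addr.
Qed.

(** * Strict upper bounds on the support *)

Section Below.
Variables (F : fieldType) (n : nat).
Implicit Types (p q : {mpoly F[n]}) (w a d e : 'X_{1..n}).

(** A bound on the support rather than on [mlead], so that it covers the zero polynomial and passes
    to specializations. The form [below e (g - 'X_[e])] says that [g] has leading monomial ['X_[e]]
    with coefficient 1. *)
Definition below w p := forall a, a \in msupp p -> (a < w)%O.

Lemma below0 w : below w 0.
Proof. by move=> a; rewrite msupp0. Qed.

Lemma belowD w p q : below w p -> below w q -> below w (p + q).
Proof.
by move=> hp hq a /msuppD_le; rewrite mem_cat => /orP[/hp|/hq].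
Qed.

Lemma belowN w p : below w p -> below w (- p).
Proof. by move=> hp a; rewrite (perm_mem (msuppN p)) => /hp. Qed.

Lemma belowB w p q : below w p -> below w q -> below w (p - q).
Proof. by move=> hp hq; apply: belowD => //; exact: belowN. Qed.

Lemma belowZ w c p : below w p -> below w (c *: p).
Proof. by move=> hp a /msuppZ_le /hp. Qed.

Lemma below_sum (I : finType) w (p : I -> {mpoly F[n]}) :
  (forall i, below w (p i)) -> below w (\sum_i p i).
Proof.
by move=> hp; elim/big_rec: _ => [|i q _ hq]; [exact: below0|exact: belowD].
Qed.

Lemma belowW w w' p : (w <= w')%O -> below w p -> below w' p.
Proof. by move=> ww hp a /hp/lt_le_trans; exact. Qed.

Lemma below_mulX w d p : below w p -> below (d + w) ('X_[d] * p).
Proof.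
move=> hp a /msuppM_le/allpairsP[[b c] [/=]].
rewrite msuppX inE => /eqP-> /hp cw ->; by rewrite ltmc_add2r.
Qed.

(** Every monomial [b] of [p] has [b + e <= w], and a monomial [c < e] of [q] gives
    [b + c < b + e]. *)
Lemma below_mul w e p q : (forall a, a \in msupp ('X_[e] * p) -> (a <= w)%O) ->
  below e q -> below w (p * q).
Proof.
move=> hp hq a /msuppM_le/allpairsP[[b c] [/= bp /hq ce ->]].
apply: (@lt_le_trans _ _ (b + e)%MM); first by rewrite ltmc_add2r.
apply: hp; rewrite -commr_mpolyX; have := msuppMX p e.
by move=> /perm_mem->; rewrite addmC; apply/mapP; exists b.
Qed.

Lemma below_sub_lead w p : (forall a, a \in msupp p -> (a <= w)%O) ->
  below w (p - p@_w *: 'X_[w]).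
Proof.
move=> hp a aq; rewrite lt_neqAle; apply/andP; split.
  apply: contraTneq aq => ->.
  by rewrite mcoeff_msupp mcoeffB mcoeffZ mcoeffX eqxx mulr1 subrr eqxx.
move: aq => /msuppB_le; rewrite mem_cat => /orP[/hp//|/msuppZ_le].
by rewrite msuppX inE => /eqP->.
Qed.

Lemma below_mlead w p : p != 0 -> below w p -> (mlead p < w)%O.
Proof. by move=> p0 /(_ _ (mlead_supp p0)). Qed.

(** Supplies the degree of a syzygy, on which Schreyer's descent runs. *)
Lemma mpoly_family_lead N (p : 'I_N -> {mpoly F[n]}) :
  (forall l, p l = 0) \/
  exists w, (exists l, w \in msupp (p l)) /\
    forall l a, a \in msupp (p l) -> (a <= w)%O.
Proof.
have [allp|/existsNP[l0 pl0]] := pselect (forall l, p l = 0); [by left|right].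
case: (@arg_maxP _ _ _ l0 (fun l => p l != 0) (fun l => mlead (p l))).
  exact/eqP.
move=> l pl lmax; exists (mlead (p l)); split.
  by exists l; exact: mlead_supp.
move=> i a ai; apply: le_trans (msupp_le_mlead ai) _; apply: lmax.
by apply: contraTneq ai => ->; rewrite msupp0.
Qed.
End Below.

(** * Division, S-pairs and their syzygies *)

Section Groebner.
Variables (F : fieldType) (n : nat).
Implicit Types (p q : {mpoly F[n]}) (w a d : 'X_{1..n}).

Section Basis.
Variables (N : nat) (g : 'I_N -> {mpoly F[n]}) (e : 'I_N -> 'X_{1..n}).
Hypothesis g_lead : forall i, below (e i) (g i - 'X_[e i]).

(** The classical S-polynomial; no leading coefficients occur since all of them are 1. *)
Definition spair i j : {mpoly F[n]} :=
  'X_[mlcm (e i) (e j) - e i] * g i - 'X_[mlcm (e i) (e j) - e j] * g j.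

Lemma below_tail_mulX w i : (e i <= w)%MM ->
  below w ('X_[w - e i] * g i - 'X_[w]).
Proof.
move=> ew; rewrite -{1 3}(submK ew) mpolyXD -mulrBr.
exact: below_mulX.
Qed.

(** Both products have leading term ['X_[w]] for the least common multiple [w]; subtracting it from
    each leaves two tails below [w]. *)
Lemma below_spair i j : below (mlcm (e i) (e j)) (spair i j).
Proof.
rewrite /spair -[X in below X _]/(mlcm (e i) (e j)); set w := mlcm _ _.
have -> : 'X_[w - e i] * g i - 'X_[w - e j] * g j =
  ('X_[w - e i] * g i - 'X_[w]) - ('X_[w - e j] * g j - 'X_[w]).
  by rewrite opprB addrA subrK.
by apply: belowB; apply: below_tail_mulX; rewrite ?lem_mlcml ?lem_mlcmr.
Qed.

(** Division with remainder zero: each step cancels the leading term and stays in [I], and the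
    process ends because the monomial order is well-founded. Bounding against every [w] above [p]
    also covers [p = 0]. *)
Lemma standard_rep (I : {mpoly F[n]} -> Prop) :
    (forall p q i, I p -> I (p - q * g i)) ->
    (forall p, I p -> p != 0 -> exists i, (e i <= mlead p)%MM) ->
  forall p, I p -> exists q : 'I_N -> {mpoly F[n]},
    p = \sum_i q i * g i /\
    forall w, below w p -> forall i, below w ('X_[e i] * q i).
Proof.
move=> I_sub I_lead p; move: {2}(mlead p) (erefl (mlead p)) => d.
elim/(well_founded_ind (@ltom_wf n)): d p => d IHd p dp Ip.
have [-> | p0] := eqVneq p 0.
  exists (fun=> 0); split; first by rewrite big1 // => i _; rewrite mul0r.
  by move=> w _ i; rewrite mulr0; exact: below0.
have [i ei] := I_lead p Ip p0; rewrite dp in ei.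
pose t : {mpoly F[n]} := mleadc p *: 'X_[d - e i].
pose p' := p - t * g i.
have p'd : below d p'.
  have -> : p' = (p - p@_d *: 'X_[d]) - mleadc p *: ('X_[d - e i] * g i - 'X_[d]).
    by rewrite scalerBr dp opprB addrA subrK /p' /t dp -scalerAl.
  apply: belowB; first by apply: below_sub_lead => a; rewrite -dp;
    exact: msupp_le_mlead.
  by apply: belowZ; exact: below_tail_mulX.
(* The case [p' = 0] is separate because [mlead 0] is a default value that need not lie below
   [d]. *)
have [q' [p'E q'd]] : exists q : 'I_N -> {mpoly F[n]}, p' = \sum_i q i * g i /\
    forall w, below w p' -> forall i, below w ('X_[e i] * q i).
  have [-> | p'0] := eqVneq p' 0.
    exists (fun=> 0); split; first by rewrite big1 // => l _; rewrite mul0r.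
    by move=> w _ l; rewrite mulr0; exact: below0.
  by apply: (IHd (mlead p')) => //; [exact: below_mlead|exact: I_sub].
exists (fun l => q' l + (if l == i then t else 0)); split.
  under eq_bigr do rewrite mulrDl; rewrite big_split /= -p'E (bigD1 i) //= eqxx.
  rewrite big1 ?addr0 ?subrK // => l /negPf->; by rewrite mul0r.
move=> w pw l; have dw : (d < w)%O by rewrite -dp; exact: below_mlead.
rewrite mulrDr; apply: belowD.
  by apply: belowW (q'd _ p'd l); exact: ltW.
case: eqP => [->|_]; last by rewrite mulr0; exact: below0.
rewrite /t -scalerAr -mpolyXD addmC submK //; apply: belowZ => a.
by rewrite msuppX inE => /eqP->.
Qed.

Variable tau : 'I_N -> 'I_N -> 'I_N -> {mpoly F[n]}.
Hypothesis tauE : forall i j, spair i j = \sum_l tau i j l * g l.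
Hypothesis tau_below : forall i j l,
  below (mlcm (e i) (e j)) ('X_[e l] * tau i j l).

(** Component [l] of the relation that arises when the standard representation [tau i j] is
    subtracted from the S-pair of [g i] and [g j]. *)
Definition spair_syzygy i j l : {mpoly F[n]} :=
  (l == i)%:R * 'X_[mlcm (e i) (e j) - e i]
  - (l == j)%:R * 'X_[mlcm (e i) (e j) - e j] - tau i j l.

Lemma sum_delta (i : 'I_N) (p : 'I_N -> {mpoly F[n]}) :
  \sum_l (l == i)%:R * p l = p i.
Proof.
rewrite (bigD1 i) //= eqxx mul1r big1 ?addr0 // => l /negPf->; exact: mul0r.
Qed.

Lemma spair_syzygyP i j : \sum_l spair_syzygy i j l * g l = 0.
Proof.
under eq_bigr do rewrite !mulrBl -!mulrA.
rewrite !sumrB.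
by rewrite !(sum_delta _ (fun l => _ * g l)) -tauE subrr.
Qed.

(* Schreyer: cancelling the leading terms of a syzygy against those of the
   S-pair syzygies through one fixed index [l0] lowers its degree, because the
   leading coefficients sum to zero. *)
Lemma schreyer (z : 'I_N -> {mpoly F[n]}) : \sum_l z l * g l = 0 ->
  exists c : 'I_N -> 'I_N -> {mpoly F[n]},
    forall l, z l = \sum_i \sum_j c i j * spair_syzygy i j l.
Proof.
have zero_case (y : 'I_N -> {mpoly F[n]}) : (forall l, 'X_[e l] * y l = 0) ->
  exists c : 'I_N -> 'I_N -> {mpoly F[n]},
    forall l, y l = \sum_i \sum_j c i j * spair_syzygy i j l.
  move=> y0; exists (fun _ _ => 0) => l.
  rewrite big1 => [|i _]; last by rewrite big1 // => j _; rewrite mul0r.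
  by have /eqP := y0 l; rewrite mulf_eq0 -msupp_eq0 msuppX => /eqP.
move=> zg; case: (mpoly_family_lead (fun l => 'X_[e l] * z l));
  first exact: zero_case.
case=> w; elim/(well_founded_ind (@ltom_wf n)): w z zg => w IHw z zg [[l0 wl0] zw].
(* [w] is the top monomial of all products of [z l] with the leading monomial of [g l], and [a l] is
   the coefficient of such a product at [w]. *)
pose a l := ('X_[e l] * z l)@_w.
have al0 : a l0 != 0 by rewrite /a -mcoeff_msupp.
have a_dvd l : a l != 0 -> (e l <= w)%MM.
  rewrite /a -mcoeff_msupp -commr_mpolyX (perm_mem (msuppMX _ _)).
  by case/mapP => b _ ->; exact: lem_addr.
have a_sum : \sum_l a l = 0.
  (* The tails of the [g l] cannot reach ['X_[w]], so the coefficient of the syzygy relation there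
     is the sum of the [a l]. *)
  have zgw l : below w (z l * (g l - 'X_[e l])) by apply: below_mul (zw l) _.
  have sum_w : (\sum_l z l * g l)@_w = 0 by rewrite zg mcoeff0.
  rewrite -[RHS]sum_w raddf_sum; apply: eq_bigr => l _ /=.
  rewrite -[g l](subrK 'X_[e l]) mulrDr mcoeffD addrC commr_mpolyX -/(a l).
  rewrite [X in _ + X]memN_msupp_eq0 ?addr0 //.
  by apply/negP => /zgw; rewrite ltxx.
(* The multiple of the S-pair syzygy of [l] and [l0] that cancels the top term of [z l]; where
   [a l = 0] the truncated subtraction of exponents is harmless. *)
pose t l : {mpoly F[n]} := a l *: 'X_[w - mlcm (e l) (e l0)].
have lcm_w l : a l != 0 -> (mlcm (e l) (e l0) <= w)%MM.
  by move=> al; rewrite lem_mlcm !a_dvd.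
pose z' l := z l - \sum_i t i * spair_syzygy i l0 l.
have z'g : \sum_l z' l * g l = 0.
  rewrite /z'; under eq_bigr do rewrite mulrBl.
  rewrite sumrB zg sub0r; apply/eqP; rewrite oppr_eq0; apply/eqP.
  under eq_bigr do rewrite mulr_suml.
  rewrite exchange_big big1 //= => i _.
  under eq_bigr do rewrite -mulrA.
  by rewrite -mulr_sumr spair_syzygyP mulr0.
have z'w l : below w ('X_[e l] * z' l).
  have tXE i : t i * 'X_[mlcm (e i) (e l0) - e i] * 'X_[e i] = a i *: 'X_[w].
    rewrite /t; have [->|ai] := eqVneq (a i) 0; first by rewrite !scale0r !mul0r.
    by rewrite -!scalerAl -mulrA -!mpolyXD !submK ?lcm_w ?lem_mlcml.
  have tXE0 i : t i * 'X_[mlcm (e i) (e l0) - e l0] * 'X_[e l0] = a i *: 'X_[w].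
    rewrite /t; have [->|ai] := eqVneq (a i) 0; first by rewrite !scale0r !mul0r.
    by rewrite -!scalerAl -mulrA -!mpolyXD !submK ?lcm_w ?lem_mlcmr.
  have -> : 'X_[e l] * z' l = ('X_[e l] * z l - a l *: 'X_[w])
      + \sum_i t i * ('X_[e l] * tau i l0 l).
    rewrite /z' mulrBr -addrA; congr (_ + _).
    apply/eqP; rewrite eqr_oppLR opprD opprK eq_sym subr_eq; apply/eqP.
    rewrite mulr_sumr -big_split /=.
    (* The second part vanishes in total because the [a i] sum to zero; it is inserted to match the
       [l0] terms of the S-pair syzygies. *)
    have -> : a l *: 'X_[w] =
      \sum_i ((i == l)%:R * (a i *: 'X_[w]) - (l == l0)%:R * (a i *: 'X_[F, w])).
      rewrite sumrB (sum_delta l (fun i => a i *: 'X_[w])) -mulr_sumr -scaler_suml.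
      by rewrite a_sum scale0r mulr0 subr0.
    apply: eq_bigr => i _ /=.
    rewrite /spair_syzygy; set x := 'X_[_ - e i]; set y := 'X_[_ - e l0].
    transitivity ((l == i)%:R * (t i * x * 'X_[e l]) - (l == l0)%:R * (t i * y *
      'X_[e l])).
      rewrite eq_sym; congr (_ - _).
        by case: eqVneq => [->|_]; rewrite ?mul0r // !mul1r tXE.
      by case: eqVneq => [->|_]; rewrite ?mul0r // !mul1r tXE0.
    by ring.
  apply: belowD; first by apply: below_sub_lead; exact: zw.
  apply: below_sum => i; rewrite /t.
  have [->|ai] := eqVneq (a i) 0; first by rewrite scale0r mul0r; exact: below0.
  rewrite -scalerAl; apply: belowZ; rewrite -{1}(submK (lcm_w _ ai)).
  exact: below_mulX.
have [c z'E] : exists c : 'I_N -> 'I_N -> {mpoly F[n]},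
    forall l, z' l = \sum_i \sum_j c i j * spair_syzygy i j l.
  case: (mpoly_family_lead (fun l => 'X_[e l] * z' l)); first exact: zero_case.
  case=> w' [[l w'l] z'w']; apply: (IHw w') => //; first exact: z'w w'l.
  by split=> //; exists l.
exists (fun i j => c i j + (j == l0)%:R * t i) => l.
rewrite -[z l](subrK (\sum_i t i * spair_syzygy i l0 l)) -/(z' l) z'E -big_split /=.
apply: eq_bigr => i _; under [in RHS]eq_bigr do rewrite mulrDl -mulrA.
by rewrite big_split /= (sum_delta l0 (fun j => t i * spair_syzygy i j l)).
Qed.
End Basis.

(** Dickson's lemma for the leading monomials of the ideal of the [f j] gives the [e i]; ideal
    members with these leading monomials are scaled to leading coefficient 1. [C] and [D] record
    both changes of generators as identities, which can be specialized. *)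
Lemma groebner_exists s (f : 'I_s -> {mpoly F[n]}) :
  exists N (g : 'I_N -> {mpoly F[n]}) (e : 'I_N -> 'X_{1..n})
    (tau : 'I_N -> 'I_N -> 'I_N -> {mpoly F[n]})
    (D : 'I_N -> 'I_s -> {mpoly F[n]}) (C : 'I_s -> 'I_N -> {mpoly F[n]}),
  [/\ forall i, below (e i) (g i - 'X_[e i]),
      forall i j, spair g e i j = \sum_l tau i j l * g l,
      forall i j l, below (mlcm (e i) (e j)) ('X_[e l] * tau i j l),
      forall i, g i = \sum_j D i j * f j &
      forall i, f i = \sum_j C i j * g j].
Proof.
pose I p := exists c : 'I_s -> {mpoly F[n]}, p = \sum_j c j * f j.
have I_lin p q r : I p -> I q -> I (p - r * q).
  move=> [c ->] [d ->]; exists (fun j => c j - r * d j).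
  by rewrite mulr_sumr -sumrB; apply: eq_bigr => j _; rewrite mulrBl mulrA.
have I0 : I 0 by exists (fun=> 0); rewrite big1 // => j _; rewrite mul0r.
have I_scale p r : I p -> I (r * p).
  by move=> Ip; rewrite -[r * p]opprK -mulNr -sub0r; exact: I_lin.
pose P a := exists p, [/\ I p, p != 0 & mlead p = a].
have [b [bP Pb]] := dickson P.
pose e i := tnth (in_tuple b) i.
have /choice[g gP] i : exists p, I p /\ below (e i) (p - 'X_[e i]).
  have [p [Ip p0]] : P (e i) by apply: bP; exact: (mem_tnth i (in_tuple b)).
  move=> <-.
  have c0 : mleadc p != 0 by rewrite mleadc_eq0.
  exists ((mleadc p)^-1 *: p); split; first by rewrite -mul_mpolyC; exact: I_scale.
  rewrite -[X in _ - X]scale1r -(mulVf c0) -scalerA -scalerBr; apply: belowZ.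
  by apply: below_sub_lead => a; exact: msupp_le_mlead.
have I_g i : I (g i) by case: (gP i).
have g_lead i : below (e i) (g i - 'X_[e i]) by case: (gP i).
have I_sub p q i : I p -> I (p - q * g i) by move=> Ip; exact: I_lin.
have I_lead p : I p -> p != 0 -> exists i, (e i <= mlead p)%MM.
  move=> Ip p0; have [|a ab ap] := Pb (mlead p); first by exists p.
  by have /tnthP[i ai] : a \in in_tuple b by []; exists i; rewrite /e -ai.
have std := standard_rep g_lead I_sub I_lead.
have /choice[t tP] (ij : 'I_(size b) * 'I_(size b)) :
    exists q : 'I_(size b) -> {mpoly F[n]},
    spair g e ij.1 ij.2 = \sum_l q l * g l /\
    forall l, below (mlcm (e ij.1) (e ij.2)) ('X_[e l] * q l).
  have [q [spE qb]] : exists q :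
    'I_(size b) -> {mpoly F[n]}, spair g e ij.1 ij.2 = \sum_l q l * g l /\
      forall w, below w (spair g e ij.1 ij.2) -> forall l, below w ('X_[e l] * q l).
    by apply: std; apply: I_lin => //; exact: I_scale.
  by exists q; split=> // l; apply: qb; exact: below_spair.
have /choice[C CP] i : exists q : 'I_(size b) -> {mpoly F[n]},
    f i = \sum_l q l * g l.
  have [|q [-> _]] := std (f i); last by exists q.
  by exists (fun j => (j == i)%:R); rewrite sum_delta.
have [D DP] := choice I_g.
exists (size b), g, e, (fun i j => t (i, j)), D, C; split=> // i j.
  by have [] := tP (i, j).
by have [_] := tP (i, j).
Qed.
End Groebner.

(** * Generic points *)

Section Generic.
Variables (k K : fieldType) (iota : {rmorphism k -> K}) (m : nat).

(** A condition containing a principal open set defined over [k]. Products of equations give finite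
    conjunctions, and the denominators to be avoided already lie in [k[u]]. *)
Definition generic (P : ('I_m -> K) -> Prop) : Prop :=
  exists2 q : {mpoly k[m]}, q != 0 &
    forall alpha, eval_u iota alpha q != 0 -> P alpha.

Lemma generic_all (P : ('I_m -> K) -> Prop) : (forall alpha, P alpha) -> generic P.
Proof. by move=> allP; exists 1; rewrite ?oner_neq0. Qed.

Lemma generic_and (P Q : ('I_m -> K) -> Prop) :
  generic P -> generic Q -> generic (fun alpha => P alpha /\ Q alpha).
Proof.
move=> [p p0 pP] [q q0 qQ]; exists (p * q); first by rewrite mulf_neq0.
move=> alpha; rewrite rmorphM mulf_eq0 negb_or => /andP[/pP ? /qQ ?]; by split.
Qed.

Lemma generic_imp (P Q : ('I_m -> K) -> Prop) :
  (forall alpha, P alpha -> Q alpha) -> generic P -> generic Q.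
Proof. by move=> PQ [p p0 pP]; exists p => // alpha /pP/PQ. Qed.

Lemma generic_forall (I : finType) (P : I -> ('I_m -> K) -> Prop) :
  (forall i, generic (P i)) -> generic (fun alpha => forall i, P i alpha).
Proof.
move=> gP; suff: generic (fun alpha => forall i, i \in enum I -> P i alpha).
  by apply: generic_imp => alpha H i; apply: H; rewrite mem_enum.
elim: (enum I) => [|i s IHs]; first exact: generic_all.
have := generic_and (gP i) IHs; apply: generic_imp => alpha [Pi Ps] j.
by rewrite inE => /orP[/eqP->|/Ps].
Qed.

(** An infinite [k] gives a point of [k^m] where [q] is nonzero; its image under [iota] shows that
    the zero locus of [q] in [K^m] is proper. *)
Lemma generic_almost_all (P : ('I_m -> K) -> Prop) :
  infinite_type k -> generic P -> almost_all P.
Proof.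
move=> k_inf [q q0 qP].
have mapE v : (map_mpoly iota q).@[v] =
  \sum_(x <- msupp q) iota q@_x * \prod_i v i ^+ x i.
  rewrite /map_mpoly /mmap raddf_sum /=; apply: eq_bigr => x _.
  by rewrite mmap1_id mevalM mevalC mevalX.
have evalE alpha : val (eval_u iota alpha q) = (map_mpoly iota q).@[alpha].
  rewrite mapE /eval_u /mmap raddf_sum /=; apply: eq_bigr => x _.
  congr (_ * _); apply: etrans (rmorph_prod (val : adjoin iota alpha -> K) _ _ _) _.
  by apply: eq_bigr => i _; rewrite rmorphXn.
exists (fun f => f = map_mpoly iota q); split.
  have [v vq] := nonzero_mpoly_value k_inf q0.
  exists (iota \o v) => /(_ _ erefl) /eqP; apply/negP; apply: contra vq.
  rewrite mapE -(fmorph_eq0 iota) mevalE rmorph_sum /= => /eqP z; apply/eqP.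
  rewrite -[RHS]z; apply: eq_bigr => x _.
  rewrite rmorphM rmorph_prod; congr (_ * _).
  by apply: eq_bigr => i _; rewrite rmorphXn.
move=> alpha nz; apply: qP; apply/eqP => q_alpha; apply: nz => _ ->.
by rewrite -evalE q_alpha.
Qed.
End Generic.

(** * Specialization of polynomials and matrices *)

Lemma fraction_ratio (D : idomainType) (c : {fraction D}) :
  exists x y : D, y != 0 /\ c = tofrac x / tofrac y.
Proof.
elim/quotW: c => r; exists \n_r, \d_r; split; first exact: denom_ratioP.
apply: (canRL (mulfK _)); first by rewrite tofrac_eq0 denom_ratioP.
unlock tofrac; rewrite -[LHS]FracField.pi_mul; apply/eqmodP => /=.
rewrite FracField.equivfE /FracField.mulf !numden_Ratio ?mulf_neq0 ?oner_neq0
  ?denom_ratioP //.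
by rewrite !mulr1 mulrC.
Qed.

Lemma map_mpoly_tofrac_inj (D : idomainType) n :
  injective (map_mpoly (@tofrac D) : {mpoly D[n]} -> {mpoly {fraction D}[n]}).
Proof.
move=> p q pq; apply/mpolyP => x; apply/eqP; rewrite -tofrac_eq.
by rewrite -2!mcoeff_map_mpoly pq.
Qed.

Section Spec.
Variables (k K : fieldType) (iota : {rmorphism k -> K}) (m n : nat).
Local Notation R := (ratpoly k m n).

Lemma common_denominator (a : R) : exists (p : {mpoly {mpoly k[m]}[n]}) q,
  q != 0 /\ a = (tofrac q)^-1 *: map_mpoly (@tofrac _) p.
Proof.
have tofrac_inj (q : {mpoly k[m]}) : q != 0 -> tofrac q != 0 by rewrite tofrac_eq0.
elim/mpolyind: a => [|c b a _ _ [p [q [q0 ->]]]].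
  by exists 0, 1; rewrite oner_neq0 raddf0 scaler0.
have [c1 [c2 [c20 cE]]] := fraction_ratio c.
have inv_polyC (d : {mpoly k[m]}) : d != 0 ->
    (tofrac d)^-1%:MP_[n] * (tofrac d)%:MP_[n] = 1.
  by move=> d0; rewrite -mpolyCM mulVf ?tofrac_eq0 // mpolyC1.
exists (c1 *: 'X_[b] * q%:MP + p * c2%:MP), (q * c2); split; first exact: mulf_neq0.
rewrite raddfD /= !rmorphM /= !map_mpolyC map_mpolyZ map_mpolyX cE.
rewrite invfM -!mul_mpolyC !rmorphM /=.
set P := map_mpoly _ p; set x := 'X_[b].
transitivity ((tofrac c1)%:MP * (tofrac c2)^-1%:MP * x
   * ((tofrac q)^-1%:MP * (tofrac q)%:MP)
   + (tofrac q)^-1%:MP * P * ((tofrac c2)^-1%:MP * (tofrac c2)%:MP_[n])).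
  by rewrite !inv_polyC // !mulr1.
by ring.
Qed.

Section Point.
Variable alpha : 'I_m -> K.
Local Notation S := {mpoly adjoin iota alpha[n]}.

(** Denominator-free form of the relation, in which sums and products are checked without
    inverses. *)
Lemma spec_poly_cleared (a : R) (b : S) : spec_poly a b -> exists p q,
  [/\ q != 0, eval_u iota alpha q != 0, tofrac q *: a = map_mpoly (@tofrac _) p &
      eval_u iota alpha q *: b = map_mpoly (eval_u iota alpha) p].
Proof.
move=> [p [q [q0 -> eq0 ->]]]; exists p, q; split => //.
  by rewrite scalerA mulfV ?tofrac_eq0 // scale1r.
by rewrite scalerA mulfV // scale1r.
Qed.

Lemma spec_poly_of_cleared (a : R) (b : S) p q :
    q != 0 -> eval_u iota alpha q != 0 -> tofrac q *: a = map_mpoly (@tofrac _) p ->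
    eval_u iota alpha q *: b = map_mpoly (eval_u iota alpha) p ->
  spec_poly a b.
Proof.
move=> q0 eq0 aE bE; exists p, q; split => //.
  by rewrite -aE scalerA mulVf ?tofrac_eq0 // scale1r.
by rewrite -bE scalerA mulVf // scale1r.
Qed.

(** Two representations of [a] agree after cross-multiplication in [k[u][x]], since [k[u]] embeds in
    its fraction field; this identity is then evaluated at [alpha]. *)
Lemma spec_poly_fun (a : R) (b b' : S) : spec_poly a b -> spec_poly a b' -> b = b'.
Proof.
move=> /spec_poly_cleared[p [q [q0 eq0 aE bE]]] /spec_poly_cleared[p' [q' [q'0
  eq'0 aE' bE']]].
have pq : q' *: p = q *: p'.
  apply: map_mpoly_tofrac_inj; rewrite !map_mpolyZ -aE -aE' !scalerA.
  by rewrite mulrC.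
have := congr1 (map_mpoly (eval_u iota alpha)) pq.
rewrite !map_mpolyZ -bE -bE' !scalerA [X in X *: b]mulrC.
by apply: scalerI; rewrite mulf_neq0.
Qed.

Lemma specializableP (a : R) : specializable iota alpha a ->
  spec_poly a (spec iota alpha a).
Proof. by rewrite /spec; case: pselect => // h _; case: (cid h). Qed.

Lemma spec_polyE (a : R) b : spec_poly a b -> spec iota alpha a = b.
Proof. move=> ab; apply: (fun h => spec_poly_fun h ab); apply: specializableP;
  by exists b. Qed.

Lemma spec_polyB (a a' : R) (b b' : S) :
  spec_poly a b -> spec_poly a' b' -> spec_poly (a - a') (b - b').
Proof.
move=> /spec_poly_cleared[p [q [q0 eq0 aE bE]]] /spec_poly_cleared[p' [q' [q'0
  eq'0 aE' bE']]].
apply: (@spec_poly_of_cleared _ _ (q' *: p - q *: p') (q * q')).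
- exact: mulf_neq0.
- by rewrite rmorphM mulf_neq0.
- by rewrite (raddfB (map_mpoly _)) /= !map_mpolyZ -aE -aE' !scalerA scalerBr
  tofracM [tofrac q' * _]mulrC.
- by rewrite (raddfB (map_mpoly _)) /= !map_mpolyZ -bE -bE' !scalerA scalerBr
  rmorphM [_ q' * _]mulrC.
Qed.

Lemma spec_polyM (a a' : R) (b b' : S) :
  spec_poly a b -> spec_poly a' b' -> spec_poly (a * a') (b * b').
Proof.
move=> /spec_poly_cleared[p [q [q0 eq0 aE bE]]] /spec_poly_cleared[p' [q' [q'0
  eq'0 aE' bE']]].
apply: (@spec_poly_of_cleared _ _ (p * p') (q * q')).
- exact: mulf_neq0.
- by rewrite rmorphM mulf_neq0.
- by rewrite (rmorphM (map_mpoly _)) /= -aE -aE' -scalerAl -scalerAr scalerA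
  tofracM.
- by rewrite (rmorphM (map_mpoly _)) /= -bE -bE' -scalerAl -scalerAr scalerA
  rmorphM.
Qed.

Lemma spec_poly_nat (d : nat) : spec_poly (d%:R : R) (d%:R : S).
Proof.
apply: (@spec_poly_of_cleared _ _ d%:R 1); rewrite ?rmorph1 ?oner_neq0 // scale1r.
  by rewrite rmorph_nat.
by rewrite rmorph_nat.
Qed.

Lemma spec_polyX x : spec_poly ('X_[x] : R) ('X_[x] : S).
Proof.
by apply: (@spec_poly_of_cleared _ _ 'X_[x] 1);
  rewrite ?rmorph1 ?oner_neq0 // scale1r map_mpolyX.
Qed.

(** Where a coefficient of [a] vanishes, so does that of the numerator, and then also its value at
    [alpha]: specialization creates no monomials. This preserves the degree bounds of a Groebner
    basis. *)
Lemma spec_poly_below w (a : R) (b : S) : spec_poly a b -> below w a -> below w b.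
Proof.
move=> /spec_poly_cleared[p [q [q0 eq0 aE bE]]] aw x xb; apply: aw; move: xb.
rewrite !mcoeff_msupp; apply: contraNneq => ax.
have px : p@_x = 0.
  apply/eqP; rewrite -tofrac_eq0 -mcoeff_map_mpoly -aE mcoeffZ ax mulr0.
  by rewrite eqxx.
have := congr1 (mcoeff x) bE;
  rewrite mcoeffZ mcoeff_map_mpoly px /= [eval_u _ _ 0]raddf0 => /eqP.
by rewrite mulf_eq0 (negPf eq0).
Qed.

Lemma spec_poly0 : spec_poly (0 : R) (0 : S).
Proof. exact: spec_poly_nat 0. Qed.

Lemma spec_polyD (a a' : R) (b b' : S) :
  spec_poly a b -> spec_poly a' b' -> spec_poly (a + a') (b + b').
Proof.
move=> ab ab'; rewrite -[a']opprK -[b']opprK -(sub0r a') -(sub0r b').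
by apply: spec_polyB ab _; apply: spec_polyB => //; exact: spec_poly0.
Qed.

Lemma spec_poly_sum (I : Type) (r : seq I) (a : I -> R) (b : I -> S) :
  (forall i, spec_poly (a i) (b i)) -> spec_poly (\sum_(i <- r) a i) (\sum_(i <-
    r) b i).
Proof.
move=> ab; elim/big_rec2: _ => [|i y x _ h]; [exact: spec_poly0|exact: spec_polyD].
Qed.
End Point.

Lemma generic_specializable (a : R) :
  generic iota (fun alpha => specializable iota alpha a).
Proof.
have [p [q [q0 aE]]] := common_denominator a.
by exists q => // alpha eq0; eexists; exists p, q; split.
Qed.
End Spec.

(** * Specialized matrices and their syzygies *)

Section SpecMatrix.
Variables (k K : fieldType) (iota : {rmorphism k -> K}) (m n : nat).
Local Notation R := (ratpoly k m n).

Lemma generic_mx r s (A : 'M[R]_(r, s)) :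
  generic iota (fun alpha => mx_specializable iota alpha A).
Proof.
by do 2!apply: generic_forall => ?; exact: generic_specializable.
Qed.

Section Point.
Variable alpha : 'I_m -> K.
Local Notation S := {mpoly adjoin iota alpha[n]}.
Local Notation spm := (spec_mx iota alpha).

Lemma spec_mxE r s (A : 'M[R]_(r, s)) (B : 'M[S]_(r, s)) :
  (forall i j, spec_poly (A i j) (B i j)) -> spm A = B.
Proof. by move=> AB; apply/matrixP => i j; rewrite mxE; exact: spec_polyE. Qed.

Lemma spec_mxP r s (A : 'M[R]_(r, s)) : mx_specializable iota alpha A ->
  forall i j, spec_poly (A i j) (spm A i j).
Proof. by move=> hA i j; rewrite mxE; exact: specializableP. Qed.

Lemma spec_mxM r s t (A : 'M[R]_(r, s)) (B : 'M[R]_(s, t)) :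
  mx_specializable iota alpha A -> mx_specializable iota alpha B ->
  spm (A *m B) = spm A *m spm B.
Proof.
move=> /spec_mxP hA /spec_mxP hB; apply: spec_mxE => i j; rewrite !mxE.
by apply: spec_poly_sum => l; exact: spec_polyM.
Qed.

Lemma spec_mxB r s (A B : 'M[R]_(r, s)) :
  mx_specializable iota alpha A -> mx_specializable iota alpha B ->
  spm (A - B) = spm A - spm B.
Proof.
move=> /spec_mxP hA /spec_mxP hB; apply: spec_mxE => i j.
rewrite [X in spec_poly X]mxE [X in spec_poly _ X]mxE.
rewrite [X in spec_poly (_ + X)]mxE [X in spec_poly _ (_ + X)]mxE.
exact: spec_polyB.
Qed.

Lemma spec_mx1 r : spm (1%:M : 'M[R]_r) = 1%:M.
Proof. by apply: spec_mxE => i j; rewrite !mxE; exact: spec_poly_nat. Qed.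

Lemma spec_col_mx r1 r2 s (A : 'M[R]_(r1, s)) (B : 'M[R]_(r2, s)) :
  spm (col_mx A B) = col_mx (spm A) (spm B).
Proof. exact: map_col_mx. Qed.

Lemma spec_row_mx r s1 s2 (A : 'M[R]_(r, s1)) (B : 'M[R]_(r, s2)) :
  spm (row_mx A B) = row_mx (spm A) (spm B).
Proof. exact: map_row_mx. Qed.

Lemma spec_mx0 r s : spm (0 : 'M[R]_(r, s)) = 0.
Proof. by apply: spec_mxE => i j; rewrite !mxE; exact: spec_poly0. Qed.
End Point.

(** The syzygies in [A] are chosen over [R], before [alpha], so one matrix serves all generic
    points. *)
Definition generic_kernel s t (B : 'M[R]_(s, t)) : Prop :=
  exists r (A : 'M[R]_(r, s)), A *m B = 0 /\
    generic iota (fun alpha => forall z : 'rV[{mpoly adjoin iota alpha[n]}]_s,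
      z *m spec_mx iota alpha B = 0 -> exists w, z = w *m spec_mx iota alpha A).

(** With [B = Cm G] and [G = Dm B], a row with [z B = 0] gives a syzygy [z Cm] of the Groebner
    basis, so [z Cm = w T] for the matrix [T] of S-pair syzygies. Then [z = z (1 - Cm Dm) + w T Dm],
    which is read over the specialized ring. *)
Lemma generic_kernel_col s (B : 'cV[R]_s) :
  generic_kernel B.
Proof.
have [N [g [e [tau [D [C [g_lead tauE tau_below gD fC]]]]]]] :=
  groebner_exists (fun i => B i 0).
pose Cm : 'M_(s, N) := \matrix_(i, j) C i j.
pose Dm : 'M_(N, s) := \matrix_(i, j) D i j.
pose G : 'cV_N := \col_i g i.
pose sigma (p : 'I_#|{: 'I_N * 'I_N}|) :=
  spair_syzygy e tau (enum_val p).1 (enum_val p).2.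
pose T := \matrix_(p, l) sigma p l.
have DB : Dm *m B = G.
  by apply/colP => i; rewrite !mxE gD; apply: eq_bigr => j _; rewrite mxE.
have CG : Cm *m G = B.
  apply/matrixP => i j; rewrite ord1 !mxE fC; apply: eq_bigr => l _.
  by rewrite !mxE.
have TG : T *m G = 0.
  apply/matrixP => p j;
    rewrite !mxE -[RHS](spair_syzygyP tauE (enum_val p).1 (enum_val p).2).
  by apply: eq_bigr => l _; rewrite !mxE.
exists _, (col_mx (1%:M - Cm *m Dm) (T *m Dm)); split.
  by rewrite mul_col_mx mulmxBl mul1mx -!mulmxA DB CG TG subrr col_mx0.
have gtau : generic iota (fun alpha =>
  forall i j l, specializable iota alpha (tau i j l)).
  by do 3!apply: generic_forall => ?; exact: generic_specializable.
have := generic_and (generic_and (generic_mx Cm) (generic_mx Dm))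
  (generic_and (generic_and (generic_mx T) (generic_mx B))
    (generic_and (generic_mx G) (generic_and gtau (generic_mx (Cm *m Dm))))).
apply: generic_imp => alpha [[hC hD] [[hT hB] [hG [htau hCD]]]] z zB.
(* Leading terms, S-pair identities and degree bounds are carried over to [alpha], so that
   Schreyer's theorem applies there. *)
pose g' i := spec iota alpha (g i).
pose tau' i j l := spec iota alpha (tau i j l).
have gS i : spec_poly (g i) (g' i).
  by apply: specializableP; have := hG i 0; rewrite mxE.
have tauS i j l : spec_poly (tau i j l) (tau' i j l) by exact: specializableP.
have g'_lead i : below (e i) (g' i - 'X_[e i]).
  by apply: spec_poly_below (g_lead i); apply: spec_polyB (gS i) (spec_polyX _ _ _).
have tau'E i j : spair g' e i j = \sum_l tau' i j l * g' l.
  have h1 : spec_poly (spair g e i j) (spair g' e i j).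
    by apply: spec_polyB; apply: spec_polyM => //; exact: spec_polyX.
  apply: (spec_poly_fun h1); rewrite tauE; apply: spec_poly_sum => l.
  exact: spec_polyM.
have tau'_below i j l : below (mlcm (e i) (e j)) ('X_[e l] * tau' i j l).
  apply: spec_poly_below (tau_below i j l); apply: spec_polyM => //.
  exact: spec_polyX.
have G'E i : spec_mx iota alpha G i 0 = g' i by rewrite !mxE.
have zCG : z *m spec_mx iota alpha Cm *m spec_mx iota alpha G = 0.
  by rewrite -mulmxA -(spec_mxM hC hG) CG.
have [c cE] : exists c : 'I_N -> 'I_N -> {mpoly adjoin iota alpha[n]}, forall l,
    (z *m spec_mx iota alpha Cm) 0 l =
      \sum_i \sum_j c i j * spair_syzygy e tau' i j l.
  apply: (schreyer g'_lead tau'E tau'_below).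
  have := congr1 (fun X : 'M_1 => X 0 0) zCG; rewrite mxE [RHS]mxE => zCG0.
  by rewrite -[RHS]zCG0; apply: eq_bigr => l _; rewrite G'E.
pose w := \row_(p < #|{: 'I_N * 'I_N}|) c (enum_val p).1 (enum_val p).2.
have zC : z *m spec_mx iota alpha Cm = w *m spec_mx iota alpha T.
  apply/rowP => l; rewrite cE mxE pair_big /= (reindex _ (onW_bij _
    (@enum_val_bij _))) /=.
  apply: eq_bigr => p _; rewrite !mxE; congr (_ * _).
  (* The specialized entries of [T] are the S-pair syzygies of the specialized basis. *)
  apply/esym/spec_polyE; apply: spec_polyB => //.
  by apply: spec_polyB; apply: spec_polyM;
    [exact: spec_poly_nat|exact: spec_polyX|exact: spec_poly_nat|exact: spec_polyX].
exists (row_mx z w); rewrite spec_col_mx mul_row_col.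
have h1 : mx_specializable iota alpha (1%:M : 'M[R]_s).
  by move=> i j; eexists; rewrite mxE; exact: spec_poly_nat.
rewrite (spec_mxB h1 hCD) spec_mx1 (spec_mxM hC hD) (spec_mxM hT hD).
by rewrite mulmxBr mulmx1 !mulmxA -zC subrK.
Qed.

(** [A1] generates the syzygies of the block [b]; those among them that also annihilate [B] come
    from the syzygies [A2] of [A1 *m B]. Hence the product [A2 *m A1]. *)
Lemma generic_kernel_row s t1 t2 (b : 'M[R]_(s, t1)) (B : 'M[R]_(s, t2)) :
    generic_kernel b -> (forall r (A : 'M_(r, s)), generic_kernel (A *m B)) ->
  generic_kernel (row_mx b B).
Proof.
move=> [r [A1 [A1b gA1]]] kB; have [r' [A2 [A2B gA2]]] := kB _ A1.
exists r', (A2 *m A1); split.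
  by rewrite mul_mx_row -!mulmxA A1b mulmx0 A2B row_mx0.
have := generic_and (generic_and gA1 gA2) (generic_and (generic_mx A1)
  (generic_and (generic_mx A2) (generic_mx B))).
apply: generic_imp => alpha [[{}gA1 {}gA2] [hA1 [hA2 hB]]] z.
rewrite spec_row_mx mul_mx_row => /eqP.
rewrite row_mx_eq0 => /andP[/eqP/gA1[w ->] /eqP].
rewrite -mulmxA -(spec_mxM hA1 hB) => /gA2[v ->]; exists v.
by rewrite (spec_mxM hA2 hA1) mulmxA.
Qed.

Lemma generic_kernelP s t (B : 'M[R]_(s, t)) : generic_kernel B.
Proof.
elim: t s B => [|t IHt] s B.
  (* Without columns every row is a syzygy. *)
  exists s, 1%:M; split; first by rewrite mul1mx; apply/matrixP => i [].
  by apply: generic_all => alpha z _; exists z; rewrite spec_mx1 mulmx1.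
pose B1 : 'M[R]_(s, 1 + t) := B.
rewrite -[B]/B1 -(hsubmxK B1); apply: (@generic_kernel_row s 1 t) => //.
exact: generic_kernel_col.
Qed.

Lemma rows_factor r s s' (X : 'M[R]_(r, s)) (A : 'M[R]_(s', s)) :
  (forall x : 'rV_r, exists z, x *m X = z *m A) -> exists Z, X = Z *m A.
Proof.
move=> XA; have /choice[f fP] i := XA (delta_mx 0 i).
exists (\matrix_i f i); apply/row_matrixP => i.
by rewrite row_mul rowK -fP -rowE.
Qed.

(* The syzygies of [C_alpha] are specializations of syzygies of [C], so a
   linear implication over [R] persists. *)
Lemma generic_transfer s t r u (C : 'M[R]_(s, t)) (D : 'M[R]_(s, u)) (A :
  'M[R]_(r, u)) :
  (forall x : 'rV_s, x *m C = 0 -> exists z, x *m D = z *m A) ->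
  generic iota (fun alpha => forall x : 'rV[{mpoly adjoin iota alpha[n]}]_s,
    x *m spec_mx iota alpha C = 0 ->
    exists z, x *m spec_mx iota alpha D = z *m spec_mx iota alpha A).
Proof.
move=> CDA; have [q [T [TC gT]]] := generic_kernelP C.
have [Z TD] : exists Z, T *m D = Z *m A.
  apply: rows_factor => x; rewrite mulmxA; apply: CDA.
  by rewrite -mulmxA TC mulmx0.
have := generic_and gT (generic_and (generic_and (generic_mx T) (generic_mx D))
  (generic_and (generic_mx Z) (generic_mx A))).
apply: generic_imp => alpha [{}gT [[hT hD] [hZ hA]]] x /gT[w ->].
by exists (w *m spec_mx iota alpha Z);
  rewrite -!mulmxA -(spec_mxM hT hD) -(spec_mxM hZ hA) TD.
Qed.
End SpecMatrix.

(** * Homomorphisms of presented modules *)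

Section InducedMaps.
Variables (R : nzRingType) (V W : lmodType R).

Lemma limageP (f : {linear V -> W}) y :
  reflect (exists x, y = f x) (y \in limage f).
Proof. exact: asboolP. Qed.

Lemma quotmod_lift (S : submodClosed V) (f : {linear V -> W}) :
    (forall x, x \in S -> f x = 0) ->
  exists g : {linear quotmod S -> W}, forall x, g (qproj S x) = f x.
Proof.
move=> fS; have /choice[g gP] y : exists z, forall x, y = qproj S x -> z = f x.
  exists (f (repr y)) => x yx; apply/eqP; rewrite -subr_eq0 -raddfB; apply/eqP.
  by apply: fS; rewrite -qproj_eq qprojK yx.
have gE x : g (qproj S x) = f x by exact: gP.
have g_lin : linear g.
  move=> a x y; rewrite -[x]qprojK -[y]qprojK -linearP !gE linearP.
  by [].
pose G := GRing.isLinear.Build R (quotmod S) W *:%R g g_lin.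
pose gl : {linear quotmod S -> W} := HB.pack g G.
by exists gl.
Qed.

Lemma submod_lift (S : submodClosed W) (f : {linear V -> W}) :
    (forall x, f x \in S) ->
  exists g : {linear V -> submod S}, forall x, incl S (g x) = f x.
Proof.
move=> fS; pose g x : submod S := Sub (f x) (fS x).
have g_lin : linear g by move=> a x y; apply: val_inj; rewrite /= !linearP.
pose gl : {linear V -> submod S} :=
  HB.pack g (GRing.isLinear.Build R V (submod S) *:%R g g_lin).
by exists gl.
Qed.

Lemma linear_bijective (f : {linear V -> W}) :
  (forall x, f x = 0 -> x = 0) -> (forall y, exists x, y = f x) -> bijective f.
Proof.
move=> f_inj /choice[g gP]; exists g => [x|y]; last by rewrite -gP.
apply/eqP; rewrite -subr_eq0; apply/eqP/f_inj.
by rewrite raddfB /= -gP subrr.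
Qed.
End InducedMaps.

(** * Matrix criteria for maps of presented modules *)

Section Presented.
Variable R : comNzRingType.

Lemma coker_surj r s (A : 'M[R]_(r, s)) (y : coker A) :
  exists x, y = coker_proj A x.
Proof. by exists (repr y); rewrite [RHS]qprojK. Qed.

Lemma coker_exact r s (A : 'M[R]_(r, s)) (x : 'rV_s) :
  coker_proj A x = 0 <-> exists z : 'rV_r, x = z *m A.
Proof.
rewrite -(raddf0 (coker_proj A)); split.
  by move/eqP; rewrite qproj_eq subr0 => /limageP.
by move=> xA; apply/eqP; rewrite qproj_eq subr0; apply/limageP.
Qed.

(** Makes a specialized module a presented one, so that the criteria below serve over [R] and over
    the specialized ring. *)
Definition coker_pres r s (A : 'M[R]_(r, s)) : presentation (coker A) :=
  Presentation (@coker_surj r s A) (@coker_exact r s A).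

Section Equations.
Variables (L : lmodType R) (G : presentation L).

Lemma pres_map_mulmx z : pres_map G (z *m pres_mx G) = 0.
Proof. by apply/pres_exact; exists z. Qed.

Lemma pres_map_eqP x y :
  pres_map G x = pres_map G y <-> exists z, x = y + z *m pres_mx G.
Proof.
split=> [xy|[z ->]]; last by rewrite raddfD /= pres_map_mulmx addr0.
have /pres_exact[z zE] : pres_map G (x - y) = 0 by rewrite raddfB /= xy subrr.
by exists z; rewrite -zE addrC subrK.
Qed.
End Equations.

(** Commutation on generators alone, which is what [spec_hom] provides for a specialized map. *)
Definition lifts (L M : lmodType R) (F : presentation L) (G : presentation M)
    (v : L -> M) (l : 'M[R]_(rank0 F, rank0 G)) : Prop :=
  forall x, pres_map G (x *m l) = v (pres_map F x).

Arguments lifts {L M} F G v l.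

(** The shape of statement that [generic_transfer] carries from [R] to the specialized rings. *)
Definition mx_implies s t r u (C : 'M[R]_(s, t)) (D : 'M[R]_(s, u))
    (A : 'M[R]_(r, u)) : Prop :=
  forall x : 'rV_s, x *m C = 0 -> exists z, x *m D = z *m A.

Lemma mul_row_col0 a b c (x : 'rV[R]_a) (y : 'rV_b) (A : 'M_(a, c)) :
  row_mx x y *m col_mx A 0 = x *m A.
Proof. by rewrite mul_row_col mulmx0 addr0. Qed.

Section Conditions.
Variables (L M1 M2 M3 : lmodType R) (G : presentation L).
Variables (F1 : presentation M1) (F2 : presentation M2) (F3 : presentation M3).

(** A row killed by [col_mx l (pres_mx G)] is a representative whose image is zero in [L], together
    with the relation proving it; [col_mx 1%:M 0] extracts the representative. *)
Lemma injective_mxP (v : {linear M1 -> L}) l : lifts F1 G v l ->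
  (forall x, v x = 0 -> x = 0) <->
  mx_implies (col_mx l (pres_mx G)) (col_mx 1%:M 0) (pres_mx F1).
Proof.
move=> vl; split=> [v_inj x|H x vx].
  rewrite -(hsubmxK x) mul_row_col mul_row_col0 mulmx1 => /eqP;
    rewrite addr_eq0 => /eqP xl.
  apply/pres_exact/v_inj; rewrite -vl xl raddfN /=.
  by rewrite pres_map_mulmx oppr0.
have [y yE] := pres_surj F1 x.
have /pres_exact[z zE] : pres_map G (y *m l) = 0 by rewrite vl -yE.
have [|t tE] := H (row_mx y (- z)).
  by rewrite mul_row_col mulNmx -zE subrr.
rewrite mul_row_col0 mulmx1 in tE.
by rewrite yE tE pres_map_mulmx.
Qed.

Lemma exact_mxP (u : {linear M1 -> M2}) (v : {linear M2 -> L}) lu lv :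
    lifts F1 F2 u lu -> lifts F2 G v lv ->
  (forall y, v y = 0 -> exists x, y = u x) <->
  mx_implies (col_mx lv (pres_mx G)) (col_mx 1%:M 0) (col_mx lu (pres_mx F2)).
Proof.
move=> ul vl; split=> [uv x|H y vy].
  rewrite -(hsubmxK x) mul_row_col mul_row_col0 mulmx1 => /eqP;
    rewrite addr_eq0 => /eqP xl.
  have [|t tE] := uv (pres_map F2 (lsubmx x)).
    by rewrite -vl xl raddfN /= pres_map_mulmx oppr0.
  have [t' t'E] := pres_surj F1 t; rewrite t'E -ul in tE.
  have [z zE] := (pres_map_eqP _ _).1 tE.
  by exists (row_mx t' z); rewrite mul_row_col.
have [x xE] := pres_surj F2 y.
have /pres_exact[z zE] : pres_map G (x *m lv) = 0 by rewrite vl -xE.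
have [|t tE] := H (row_mx x (- z)).
  by rewrite mul_row_col mulNmx -zE subrr.
rewrite mul_row_col0 mulmx1 -(hsubmxK t) mul_row_col in tE.
exists (pres_map F1 (lsubmx t)).
by rewrite xE tE raddfD /= pres_map_mulmx addr0 ul.
Qed.

(** The premise on a matrix without columns always holds, so the implication becomes an
    unconditional statement on all rows. *)
Lemma comp0_mxP (u : {linear M1 -> M2}) (v : {linear M2 -> L}) lu lv :
    lifts F1 F2 u lu -> lifts F2 G v lv ->
  (forall x, v (u x) = 0) <->
  mx_implies (0 : 'M_(_, 0)) (lu *m lv) (pres_mx G).
Proof.
move=> ul vl; split=> [uv x _|H x].
  by apply/pres_exact; rewrite mulmxA vl ul.
have [y yE] := pres_surj F1 x.
have [|z zE] := H y; first by rewrite mulmx0.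
by rewrite yE -ul -vl -mulmxA zE pres_map_mulmx.
Qed.

Lemma surjective_mxP (v : {linear M1 -> L}) l : lifts F1 G v l ->
  (forall y, exists x, y = v x) <->
  mx_implies (0 : 'M_(_, 0)) 1%:M (col_mx l (pres_mx G)).
Proof.
move=> vl; split=> [v_surj x _|H y].
  have [y yE] := v_surj (pres_map G x).
  have [y' y'E] := pres_surj F1 y; rewrite y'E -vl in yE.
  have [z zE] := (pres_map_eqP _ _).1 yE.
  by exists (row_mx y' z); rewrite mul_row_col mulmx1.
have [x xE] := pres_surj G y.
have [|t] := H x; first by rewrite mulmx0.
rewrite mulmx1 -(hsubmxK t) mul_row_col => tE.
exists (pres_map F1 (lsubmx t)).
by rewrite xE tE raddfD /= pres_map_mulmx addr0 vl.
Qed.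

(** A row killed by the stacked matrix encodes an equation [f1 x1 = f2 x2], with the sign absorbed
    into [x2]; the conclusion places [f1 x1] in the image of [f3]. *)
Lemma meet_mxP (f1 : {linear M1 -> L}) (f2 : {linear M2 -> L})
    (f3 : {linear M3 -> L}) l1 l2 l3 :
    lifts F1 G f1 l1 -> lifts F2 G f2 l2 -> lifts F3 G f3 l3 ->
  (forall x1 x2, f1 x1 = f2 x2 -> exists x3, f1 x1 = f3 x3) <->
  mx_implies (col_mx l1 (col_mx l2 (pres_mx G))) (col_mx l1 0)
    (col_mx l3 (pres_mx G)).
Proof.
move=> h1 h2 h3; split=> [f123 x|H x1 x2 x12].
  rewrite -(hsubmxK x) -(hsubmxK (rsubmx x)) mul_row_col0 !mul_row_col.
  set x1 := lsubmx x; set x2 := lsubmx _; set y := rsubmx _ => /eqP;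
    rewrite addr_eq0 => /eqP xl.
  have [|x3] := f123 (pres_map F1 x1) (pres_map F2 (- x2)).
    rewrite -h1 -h2; apply/pres_map_eqP; exists (- y).
    by rewrite xl opprD !mulNmx.
  have [x3' ->] := pres_surj F3 x3; rewrite -h1 -h3 => /pres_map_eqP[z zE].
  by exists (row_mx x3' z); rewrite mul_row_col.
have [y1 y1E] := pres_surj F1 x1; have [y2 y2E] := pres_surj F2 x2.
move: x12; rewrite y1E y2E -h1 -h2 => /pres_map_eqP[z zE].
have [|t] := H (row_mx y1 (row_mx (- y2) (- z))).
  by rewrite !mul_row_col zE !mulNmx -opprD subrr.
rewrite mul_row_col0 -(hsubmxK t) mul_row_col => tE.
exists (pres_map F3 (lsubmx t)).
by rewrite tE raddfD /= pres_map_mulmx addr0 h3.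
Qed.

Lemma sum_mxP (f1 : {linear M1 -> L}) (f2 : {linear M2 -> L})
    (f3 : {linear M3 -> L}) l1 l2 l3 :
    lifts F1 G f1 l1 -> lifts F2 G f2 l2 -> lifts F3 G f3 l3 ->
  (forall x3, exists x1 x2, f3 x3 = f1 x1 + f2 x2) <->
  mx_implies (0 : 'M_(_, 0)) l3 (col_mx l1 (col_mx l2 (pres_mx G))).
Proof.
move=> h1 h2 h3; split=> [f123 x _|H x3].
  have [x1 [x2]] := f123 (pres_map F3 x).
  have [y1 ->] := pres_surj F1 x1; have [y2 ->] := pres_surj F2 x2.
  rewrite -h1 -h2 -h3 -raddfD => /pres_map_eqP[z zE].
  by exists (row_mx y1 (row_mx y2 z)); rewrite !mul_row_col addrA.
have [x xE] := pres_surj F3 x3.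
have [|t] := H x; first by rewrite mulmx0.
rewrite -(hsubmxK t) -(hsubmxK (rsubmx t)) !mul_row_col => tE.
exists (pres_map F1 (lsubmx t)), (pres_map F2 (lsubmx (rsubmx t))).
by rewrite xE -h3 tE !raddfD /= pres_map_mulmx addr0 h1 h2.
Qed.
End Conditions.
End Presented.
Arguments lifts {R L M} F G v l.

(** * Generic properties of specialized homomorphisms *)

Section SpecHom.
Variables (k K : fieldType) (iota : {rmorphism k -> K}) (m n : nat).
Local Notation R := (ratpoly k m n).
Variables (L M1 M2 M3 : lmodType R) (G : presentation L).
Variables (F1 : presentation M1) (F2 : presentation M2) (F3 : presentation M3).

Definition spec_pres (M : lmodType R) (F : presentation M) alpha :
  presentation (spec_mod iota alpha F) := coker_pres (spec_mx iota alpha (pres_mx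
    F)).

Lemma spec_hom_lifts (M N : lmodType R) (F : presentation M) (H : presentation N)
    (v : {linear M -> N}) (l : pres_lift F H v) alpha w :
  spec_hom (alpha := alpha) l w ->
  lifts (spec_pres F alpha) (spec_pres H alpha) w (spec_mx iota alpha (Defs.lift0
    l)).
Proof. by case=> _ _ _ _ wl x; rewrite wl. Qed.

(** The specialized identity between [lift0] and [lift1] makes the map of free modules respect the
    relations, so it descends to the cokernels. *)
Lemma generic_spec_hom (v : {linear M1 -> L}) (l : pres_lift F1 G v) :
  generic iota (fun alpha =>
    exists w : {linear spec_mod iota alpha F1 -> _}, spec_hom l w).
Proof.
have := generic_and (generic_and (generic_mx iota (pres_mx F1)) (generic_mx iota
  (pres_mx G)))
  (generic_and (generic_mx iota (Defs.lift0 l)) (generic_mx iota (lift1 l))).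
apply: generic_imp => alpha [[hF hG] [h0 h1]].
pose f : {linear 'rV_(rank0 F1) -> spec_mod iota alpha G} :=
  coker_proj (spec_mx iota alpha (pres_mx G)) \o mulmxr (spec_mx iota alpha
    (Defs.lift0 l)).
have [|w wE] := @quotmod_lift _ _ _
    (limage (mulmxr (spec_mx iota alpha (pres_mx F1)) :
      {linear 'rV_(rank1 F1) -> 'rV_(rank0 F1)})) f.
  move=> _ /limageP[z ->]; apply/coker_exact;
    exists (z *m spec_mx iota alpha (lift1 l)).
  by rewrite /= -!mulmxA -(spec_mxM hF h0) -(spec_mxM h1 hG) lift1P.
by exists w; split.
Qed.

(** The criterion is applied over [R], transferred, and read backwards over the specialized ring.
    The next lemmas follow the same pattern. *)
Lemma generic_injective (v : {linear M1 -> L}) (l : pres_lift F1 G v) :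
    (forall x, v x = 0 -> x = 0) ->
  generic iota (fun alpha => forall w : {linear spec_mod iota alpha F1 -> _},
    spec_hom l w -> forall x, w x = 0 -> x = 0).
Proof.
move/(injective_mxP (lift0P l))/(generic_transfer iota).
apply: generic_imp => alpha; rewrite !spec_col_mx spec_mx1 spec_mx0 => H w.
by move/spec_hom_lifts => wl; apply/(injective_mxP wl).
Qed.

Lemma generic_exact (u : {linear M1 -> M2}) (v : {linear M2 -> L})
    (lu : pres_lift F1 F2 u) (lv : pres_lift F2 G v) :
    (forall y, v y = 0 -> exists x, y = u x) ->
  generic iota (fun alpha => forall (wu : {linear spec_mod iota alpha F1 -> _})
      (wv : {linear spec_mod iota alpha F2 -> _}),
    spec_hom lu wu -> spec_hom lv wv -> forall y, wv y = 0 -> exists x, y = wu x).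
Proof.
move/(exact_mxP (lift0P lu) (lift0P lv))/(generic_transfer iota).
apply: generic_imp => alpha; rewrite !spec_col_mx spec_mx1 spec_mx0 => H wu wv.
by move=> /spec_hom_lifts wul /spec_hom_lifts wvl; apply/(exact_mxP wul wvl).
Qed.

Lemma generic_comp0 (u : {linear M1 -> M2}) (v : {linear M2 -> L})
    (lu : pres_lift F1 F2 u) (lv : pres_lift F2 G v) :
    (forall x, v (u x) = 0) ->
  generic iota (fun alpha => forall (wu : {linear spec_mod iota alpha F1 -> _})
      (wv : {linear spec_mod iota alpha F2 -> _}),
    spec_hom lu wu -> spec_hom lv wv -> forall x, wv (wu x) = 0).
Proof.
move/(comp0_mxP (lift0P lu) (lift0P lv))/(generic_transfer iota).
move/(generic_and (generic_and (generic_mx iota (Defs.lift0 lu)) (generic_mx iota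
  (Defs.lift0 lv)))).
apply: generic_imp => alpha [[hu hv]]; rewrite (spec_mxM hu hv) spec_mx0 => H wu wv.
by move=> /spec_hom_lifts wul /spec_hom_lifts wvl; apply/(comp0_mxP wul wvl).
Qed.

Lemma generic_surjective (v : {linear M1 -> L}) (l : pres_lift F1 G v) :
    (forall y, exists x, y = v x) ->
  generic iota (fun alpha => forall w : {linear spec_mod iota alpha F1 -> _},
    spec_hom l w -> forall y, exists x, y = w x).
Proof.
move/(surjective_mxP (lift0P l))/(generic_transfer iota).
apply: generic_imp => alpha; rewrite !spec_col_mx spec_mx1 spec_mx0 => H w.
by move/spec_hom_lifts => wl; apply/(surjective_mxP wl).
Qed.

Lemma generic_meet (f1 : {linear M1 -> L}) (f2 : {linear M2 -> L})
    (f3 : {linear M3 -> L}) (l1 : pres_lift F1 G f1) (l2 : pres_lift F2 G f2)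
    (l3 : pres_lift F3 G f3) :
    (forall x1 x2, f1 x1 = f2 x2 -> exists x3, f1 x1 = f3 x3) ->
  generic iota (fun alpha => forall (w1 : {linear spec_mod iota alpha F1 -> _})
      (w2 : {linear spec_mod iota alpha F2 -> _})
      (w3 : {linear spec_mod iota alpha F3 -> _}),
    spec_hom l1 w1 -> spec_hom l2 w2 -> spec_hom l3 w3 ->
    forall x1 x2, w1 x1 = w2 x2 -> exists x3, w1 x1 = w3 x3).
Proof.
move/(meet_mxP (lift0P l1) (lift0P l2) (lift0P l3))/(generic_transfer iota).
apply: generic_imp => alpha; rewrite !spec_col_mx spec_mx0 => H w1 w2 w3.
move=> /spec_hom_lifts wl1 /spec_hom_lifts wl2 /spec_hom_lifts wl3.
by apply/(meet_mxP wl1 wl2 wl3).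
Qed.

Lemma generic_sum (f1 : {linear M1 -> L}) (f2 : {linear M2 -> L})
    (f3 : {linear M3 -> L}) (l1 : pres_lift F1 G f1) (l2 : pres_lift F2 G f2)
    (l3 : pres_lift F3 G f3) :
    (forall x3, exists x1 x2, f3 x3 = f1 x1 + f2 x2) ->
  generic iota (fun alpha => forall (w1 : {linear spec_mod iota alpha F1 -> _})
      (w2 : {linear spec_mod iota alpha F2 -> _})
      (w3 : {linear spec_mod iota alpha F3 -> _}),
    spec_hom l1 w1 -> spec_hom l2 w2 -> spec_hom l3 w3 ->
    forall x3, exists x1 x2, w3 x3 = w1 x1 + w2 x2).
Proof.
move/(sum_mxP (lift0P l1) (lift0P l2) (lift0P l3))/(generic_transfer iota).
apply: generic_imp => alpha; rewrite !spec_col_mx spec_mx0 => H w1 w2 w3.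
move=> /spec_hom_lifts wl1 /spec_hom_lifts wl2 /spec_hom_lifts wl3.
by apply/(sum_mxP wl1 wl2 wl3).
Qed.
End SpecHom.

(** [generic_meet] with the first map taken twice, which reduces its hypothesis to an inclusion of
    images. *)
Lemma generic_image_le (k K : fieldType) (iota : {rmorphism k -> K}) (m n : nat)
    (L M1 M2 : lmodType (ratpoly k m n)) (G : presentation L)
    (F1 : presentation M1) (F2 : presentation M2)
    (f1 : {linear M1 -> L}) (f2 : {linear M2 -> L})
    (l1 : pres_lift F1 G f1) (l2 : pres_lift F2 G f2) :
    (forall x1, exists x2, f1 x1 = f2 x2) ->
  generic iota (fun alpha => forall (w1 : {linear spec_mod iota alpha F1 -> _})
      (w2 : {linear spec_mod iota alpha F2 -> _}),
    spec_hom l1 w1 -> spec_hom l2 w2 -> forall x1, exists x2, w1 x1 = w2 x2).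
Proof.
move=> f12; have := @generic_meet _ _ iota _ _ _ _ _ _ _ _ _ _ _ _ _ l1 l1 l2
  (fun x _ _ => f12 x).
by apply: generic_imp => alpha H w1 w2 wl1 wl2 x;
  exact: (H w1 w1 w2 wl1 wl1 wl2 x x erefl).
Qed.

(** * Quotients, intersections and sums of specialized submodules *)

Theorem proposition3p2 (k K : fieldType) (iota : {rmorphism k -> K})
    (k_inf : infinite_type k) (m n : nat)
    (L : lmodType (ratpoly k m n)) (L_fg : fin_gen L) (M N : submodClosed L)
    (PL : presentation L)
    (PM : presentation (submod M)) (PN : presentation (submod N))
    (PQ : presentation (quotmod M))
    (PI : presentation (submod (submodI M N)))
    (PS : presentation (submod (submodD M N)))
    (lM : pres_lift PM PL (incl M)) (lN : pres_lift PN PL (incl N))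
    (lQ : pres_lift PL PQ (qproj M))
    (lI : pres_lift PI PL (incl (submodI M N)))
    (lS : pres_lift PS PL (incl (submodD M N))) :
  almost_all (fun alpha : 'I_m -> K =>
    exists (iM : {linear spec_mod iota alpha PM -> spec_mod iota alpha PL})
           (iN : {linear spec_mod iota alpha PN -> spec_mod iota alpha PL})
           (pQ : {linear spec_mod iota alpha PL -> spec_mod iota alpha PQ})
           (iI : {linear spec_mod iota alpha PI -> spec_mod iota alpha PL})
           (iS : {linear spec_mod iota alpha PS -> spec_mod iota alpha PL}),
      [/\ [/\ spec_hom lM iM, spec_hom lN iN, spec_hom lQ pQ,
              spec_hom lI iI & spec_hom lS iS],
          injective iM /\ injective iN,
          (exists f : {linear quotmod (limage iM) -> spec_mod iota alpha PQ},
             bijective f /\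
             forall x, f (qproj (limage iM) x) = pQ x),
          (exists f : {linear spec_mod iota alpha PI ->
                              submod (submodI (limage iM) (limage iN))},
             bijective f /\
             forall x, incl (submodI (limage iM) (limage iN)) (f x) = iI x) &
          (exists f : {linear spec_mod iota alpha PS ->
                              submod (submodD (limage iM) (limage iN))},
             bijective f /\
             forall x, incl (submodD (limage iM) (limage iN)) (f x) = iS x)]).
Proof.
have incl_inj (S : submodClosed L) (x : submod S) : incl S x = 0 -> x = 0.
  by move=> x0; apply: val_inj; rewrite /= -[LHS]/(incl S x) x0.
have incl_in (S : submodClosed L) (x : submod S) : incl S x \in S by exact: valP.
have incl_sub (S : submodClosed L) y : y \in S -> exists x : submod S, y = incl S x.
  by move=> yS; exists (Sub y yS).
apply: (generic_almost_all (iota := iota)) => //.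
have g_hom := generic_and (generic_and (generic_spec_hom iota lM)
  (generic_spec_hom iota lN))
  (generic_and (generic_spec_hom iota lQ)
    (generic_and (generic_spec_hom iota lI) (generic_spec_hom iota lS))).
have g_inj := generic_and (generic_and (generic_injective iota lM (incl_inj M))
    (generic_injective iota lN (incl_inj N)))
  (generic_and (generic_injective iota lI (incl_inj _))
    (generic_injective iota lS (incl_inj _))).
(* Exactness of the sequence from [M] through [L] onto the quotient is carried over to [alpha]. *)
have g_Q : generic iota (fun alpha =>
  forall (wM : {linear spec_mod iota alpha PM -> _})
    (wQ : {linear spec_mod iota alpha PL -> _}), spec_hom lM wM -> spec_hom lQ wQ ->
  [/\ forall x, wQ (wM x) = 0, forall y, wQ y = 0 -> exists x, y = wM x
    & forall y, exists x, y = wQ x]).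
  have comp x : qproj M (incl M x) = 0.
    by apply/eqP; rewrite -(raddf0 (qproj M)) qproj_eq subr0.
  have ker y : qproj M y = 0 -> exists x, y = incl M x.
    by move/eqP; rewrite -(raddf0 (qproj M)) qproj_eq subr0 => /incl_sub.
  have surj y : exists x, y = qproj M x by exists (repr y); rewrite qprojK.
  have := generic_and (generic_comp0 iota lM lQ comp)
    (generic_and (generic_exact iota lM lQ ker) (generic_surjective iota lQ surj)).
  apply: generic_imp => alpha [H1 [H2 H3]] wM wQ hM hQ.
  by split; [exact: H1|exact: H2|exact: H3].
(* One inclusion comes from [generic_image_le] for both submodules, the other from
   [generic_meet]. *)
have g_I : generic iota (fun alpha =>
  forall (wM : {linear spec_mod iota alpha PM -> _})
    (wN : {linear spec_mod iota alpha PN -> _})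
    (wI : {linear spec_mod iota alpha PI -> _}),
  spec_hom lM wM -> spec_hom lN wN -> spec_hom lI wI ->
  (forall x, wI x \in submodI (limage wM) (limage wN)) /\
  (forall y, y \in submodI (limage wM) (limage wN) -> exists x, y = wI x)).
  have IM x : exists y, incl (submodI M N) x = incl M y.
    by apply: incl_sub; case/andP: (incl_in _ x).
  have IN x : exists y, incl (submodI M N) x = incl N y.
    by apply: incl_sub; case/andP: (incl_in _ x).
  have MNI x y : incl M x = incl N y -> exists z, incl M x = incl (submodI M N) z.
    by move=> xy; apply: incl_sub; apply/andP; split;
      rewrite ?incl_in // xy incl_in.
  have := generic_and (generic_and (generic_image_le iota lI lM IM)
    (generic_image_le iota lI lN IN)) (generic_meet iota lM lN lI MNI).
  apply: generic_imp => alpha [[H1 H2] H3] wM wN wI hM hN hI; split=> [x|y].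
    by apply/andP; split; apply/limageP; [exact: H1|exact: H2].
  by case/andP => /limageP[x1 ->] /limageP[x2 x12]; exact: H3 x12.
have g_S : generic iota (fun alpha =>
  forall (wM : {linear spec_mod iota alpha PM -> _})
    (wN : {linear spec_mod iota alpha PN -> _})
    (wS : {linear spec_mod iota alpha PS -> _}),
  spec_hom lM wM -> spec_hom lN wN -> spec_hom lS wS ->
  (forall x, wS x \in submodD (limage wM) (limage wN)) /\
  (forall y, y \in submodD (limage wM) (limage wN) -> exists x, y = wS x)).
  have MS x : exists y, incl M x = incl (submodD M N) y.
    apply: incl_sub; apply/asboolP; exists (incl M x), 0.
    by rewrite incl_in rpred0 addr0.
  have NS x : exists y, incl N x = incl (submodD M N) y.
    apply: incl_sub; apply/asboolP; exists 0, (incl N x).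
    by rewrite incl_in rpred0 add0r.
  have SMN z : exists x y, incl (submodD M N) z = incl M x + incl N y.
    have /asboolP[_ [_ [/incl_sub[x ->] /incl_sub[y ->] ->]]] := incl_in _ z.
    by exists x, y.
  have := generic_and (generic_and (generic_image_le iota lM lS MS)
    (generic_image_le iota lN lS NS)) (generic_sum iota lM lN lS SMN).
  apply: generic_imp => alpha [[H1 H2] H3] wM wN wS hM hN hS; split=> [z|y].
    have [x [y ->]] := H3 _ _ _ hM hN hS z.
    by apply/asboolP; exists (wM x), (wN y); split=> //; apply/limageP; eexists.
  case/asboolP => _ [_ [/limageP[a ->] /limageP[b ->] ->]].
  (* Both summands are moved into the image of [wS] and added there. *)
  have [a' ->] := H1 _ _ hM hS a; have [b' ->] := H2 _ _ hN hS b.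
  by exists (a' + b'); rewrite raddfD.
have := generic_and (generic_and g_hom g_inj) (generic_and g_Q (generic_and g_I
  g_S)).
apply: generic_imp => alpha [[[[[iM hM] [iN hN]] [[pQ hQ] [[iI hI] [iS hS]]]]
  [[injM injN] [injI injS]]] [gQ [gI gS]]].
have zero_inj (U V : lmodType {mpoly adjoin iota alpha[n]}) (f : {linear U -> V}) :
    (forall x, f x = 0 -> x = 0) -> injective f.
  move=> f0 x y xy; apply/eqP; rewrite -subr_eq0; apply/eqP/f0.
  by rewrite raddfB /= xy subrr.
(* An injective map with image [S] corestricts to an isomorphism onto [S]; this serves for the
   intersection and for the sum. *)
have sub_iso (U V : lmodType {mpoly adjoin iota alpha[n]}) (S : submodClosed V)
    (f : {linear U -> V}) : (forall x, f x = 0 -> x = 0) ->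
    (forall x, f x \in S) /\ (forall y, y \in S -> exists x, y = f x) ->
    exists g : {linear U -> submod S}, bijective g /\ forall x, incl S (g x) = f x.
  move=> f0 [fS Sf]; have [g gE] := submod_lift fS.
  exists g; split=> //; apply: linear_bijective => [x gx|y].
    by apply: f0; rewrite -gE gx raddf0.
  have [x xE] := Sf (incl S y) (valP y); exists x.
  by apply: val_inj; rewrite -[LHS]/(incl S y) xE -gE.
exists iM, iN, pQ, iI, iS; split => //.
- by split; apply: zero_inj; [exact: injM|exact: injN].
- have [comp ker surj] := gQ _ _ hM hQ.
  (* [pQ] kills the image of [iM] and so factors through the quotient; exactness makes the factor
     injective, and surjectivity of [pQ] makes it onto. *)
  have [|f fE] := @quotmod_lift _ _ _ (limage iM) pQ.
    by move=> _ /limageP[x ->].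
  exists f; split=> //; apply: linear_bijective => [x|y].
    rewrite -[x]qprojK fE => /ker x_im; apply/eqP.
    by rewrite -(raddf0 (qproj (limage iM))) qproj_eq subr0; apply/limageP.
  by have [x ->] := surj y; exists (qproj (limage iM) x); rewrite fE.
- by apply: sub_iso; [exact: injI|exact: gI].
- by apply: sub_iso; [exact: injS|exact: gS].
Qed.
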